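(* Let $\mathcal H$ be a commutative non-degenerate combinatorial Hopf algebra and let $(S_v)_v$ be a substitution for $\mathcal H$-rough paths with associated coaction $\rho_S:\mathcal H\to S(\mathcal H_{in}\times\mathcal B_1)\otimes\mathcal H$. Then the Hopf algebra $(S(\mathcal H_{in}\times\mathcal B_1),\cdot,\Delta_{\cdot})$ is in cointeraction with $(\mathcal H,\odot,\Delta)$ by the coaction $\rho_S$; that is, for all $x,y\in\mathcal H$: $\rho_S(1)=1\otimes1$, $\rho_S(x\odot y)=\rho_S(x)(\cdot\otimes\odot)\rho_S(y)$, $(\mathrm{Id}\otimes\epsilon)\rho_S=1\,\epsilon$, and $(\mathrm{Id}\otimes\Delta)\rho_S=m^{1,3}(\rho_S\otimes\rho_S)\Delta$, where $m^{1,3}(a\otimes b\otimes c\otimes d)=a\cdot c\otimes b\otimes d$.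
   Context: **Combinatorial Hopf algebras.** The ground field is $\mathbb K=\mathbb R$. A combinatorial Hopf algebra is a graded connected Hopf algebra $\mathcal H=\bigoplus_{n\ge0}\mathcal H_n$ (connected: the unit map is an isomorphism $\mathbb K\to\mathcal H_0$) with product $\odot$, coproduct $\Delta$, counit $\epsilon$, together with a basis $\mathcal B=\bigcup_n\mathcal B_n$ of homogeneous elements ($\mathcal B_n\subset\mathcal H_n$) such that $\dim\mathcal H_n\le bc^n$ for some positive constants $b,c$, and the structure constants of $\odot$ and $\Delta$ in the basis $\mathcal B$ are non-negative integers. It is non-degenerate if $\mathcal B\cap\mathrm{Prim}(\mathcal H)=\mathcal B_1$. Write $\mathcal B_1=\{e_1,\dots,e_n\}$ and $|x|$ for degree. **Duals.** $\mathcal H^*$ is the graded dual, with product $*$ dual to $\Delta$ and coproduct $\Delta_\odot$ dual to $\odot$; it is identified with $\mathcal H$ through the basis dual to $\mathcal B$ (so $e_i$ also denotes the dual basis element). $\overline{\mathcal H^*}=\prod_n\mathcal H_n^*$ is its completion, i.e. all linear forms on $\mathcal H$, with convolution product $*$ and the completed coproduct. $v\in\overline{\mathcal H^*}$ is primitive if it vanishes on $1$ and on $\ker\epsilon\odot\ker\epsilon$ (infinitesimal character). Characters are unital algebra morphisms $(\mathcal H,\odot)\to\mathbb K$. **The Hopf algebra $S$.** $\mathcal H_{in}=\ker\epsilon/(\ker\epsilon\odot\ker\epsilon)$ denotes the indecomposables; $\mathcal H_{in}\times\mathcal B_1$ is the vector space of pairs $(w,e_i)$, linear in the first component (so it is $\bigoplus_i\mathcal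 H_{in}$). $(S(\mathcal H_{in}\times\mathcal B_1),\cdot,\Delta_{\cdot})$ is the free commutative algebra on it, with the coproduct for which generators are primitive. For a tuple $v=\{v_1,\dots,v_n\}$ of primitive elements of $\overline{\mathcal H^*}$, $e^v=\exp^{\cdot}(\sum_i(v_i,e_i))$ is the character of $S(\mathcal H_{in}\times\mathcal B_1)$ with $\langle e^v,(w,e_i)\rangle=\langle v_i,w\rangle$. **Rough paths.** For $\gamma\in(0,1]$, a $\gamma$-regular $\mathcal H$-rough path is a family $(\mathbb X_{st})_{s,t\in\mathbb R}$ of linear forms on $\mathcal H$ with $\langle\mathbb X_{st},1\rangle=1$, $\langle\mathbb X_{st},x\odot y\rangle=\langle\mathbb X_{st},x\rangle\langle\mathbb X_{st},y\rangle$, $\mathbb X_{su}*\mathbb X_{ut}=\mathbb X_{st}$, and $\sup_{s\ne t}|\langle\mathbb X_{st},x\rangle|/|t-s|^{\gamma|x|}<\infty$ for every $x\in\mathcal B$. **Substitution.** A family of algebra morphisms $S_v:\overline{\mathcal H^*}\to\overline{\mathcal H^*}$, indexed by tuples $v=\{v_1,\dots,v_n\}$ of primitive elements of $\overline{\mathcal H^*}$, is a substitution if: 1. $S_v(e_i)=v_i$ for all $e_i\in\mathcal B_1$; 2. $S_v\circ S_u=S_{S_v(u)}$, where $S_v(u)=\{S_v(u_1),\dots,S_v(u_n)\}$; 3. for each ($\gamma$-regular) $\mathcal H$-rough path $\mathbb X$, $S_v(\mathbb X)_{st}:=S_v(\mathbb X_{st})$ is an $\mathcal H$-rough path: (a)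 $S_v$ maps characters to characters, (b) $S_v$ is a morphism for $*$, (c) $\sup_{s\ne t}|\langle S_v(\mathbb X_{st}),x\rangle|/|t-s|^{\gamma|x|}<\infty$ for $x\in\mathcal B$; 4. there is a coaction (linear map; no coassociativity is required) $\rho_S:\mathcal H\to S(\mathcal H_{in}\times\mathcal B_1)\otimes\mathcal H$ with $\langle S_v(\chi),x\rangle=\langle e^v\otimes\chi,\rho_S(x)\rangle$ for all $\chi\in\overline{\mathcal H^*}$, $x\in\mathcal H$ and all $v$. *)

(* Defs.v *)
From HB Require Import structures.
From mathcomp Require Import all_boot all_order all_algebra.
From mathcomp Require Import generic_quotient ring_quotient sesquilinear.
From mathcomp Require Import all_classical all_reals exp.

Set Implicit Arguments.
Unset Strict Implicit.
Unset Printing Implicit Defensive.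

Import Order.TTheory GRing.Theory Num.Theory.

Local Open Scope classical_set_scope.
Local Open Scope quotient_scope.
Local Open Scope ring_scope.

Reserved Notation "V ⨂ W" (at level 40, left associativity).
Reserved Notation "v ⊗ w" (at level 40, left associativity).

Notation bilinear_map := (bilinear_for *:%R *:%R).

(* V ⨂ W, by generators and relations: formal linear combinations of symbols
   v ⊗ w modulo the module laws and the bilinearity of v ⊗ w. *)
Section Tensor.
Variables (K : fieldType) (V W : lmodType K).

Inductive texp : Type :=
| Tzero
| Tpure of V & W
| Tadd of texp & texp
| Tscale of K & texp.

Inductive teq : texp -> texp -> Prop :=
| teq_refl x : teq x x
| teq_sym x y : teq x y -> teq y x
| teq_trans x y z : teq x y -> teq y z -> teq x z
| teq_add x x' y y' : teq x x' -> teq y y' -> teq (Tadd x y) (Tadd x' y')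
| teq_scale a x x' : teq x x' -> teq (Tscale a x) (Tscale a x')
| teq_addA x y z : teq (Tadd x (Tadd y z)) (Tadd (Tadd x y) z)
| teq_addC x y : teq (Tadd x y) (Tadd y x)
| teq_add0 x : teq (Tadd Tzero x) x
| teq_scale0 x : teq (Tscale 0 x) Tzero
| teq_scaleA a b x : teq (Tscale a (Tscale b x)) (Tscale (a * b) x)
| teq_scale1 x : teq (Tscale 1 x) x
| teq_scaleDr a x y : teq (Tscale a (Tadd x y)) (Tadd (Tscale a x) (Tscale a y))
| teq_scaleDl a b x : teq (Tscale (a + b) x) (Tadd (Tscale a x) (Tscale b x))
| teq_linl a v v' w :
    teq (Tpure (a *: v + v') w) (Tadd (Tscale a (Tpure v w)) (Tpure v' w))
| teq_linr a v w w' :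
    teq (Tpure v (a *: w + w')) (Tadd (Tscale a (Tpure v w)) (Tpure v w')).

HB.instance Definition _ := gen_eqMixin texp.
HB.instance Definition _ := gen_choiceMixin texp.

Definition teqb x y := `[< teq x y >].

Lemma teqb_equiv : equiv_class_of teqb.
Proof.
split=> [x|x y|y x z].
- exact/asboolP/teq_refl.
- by apply/asboolP/asboolP; apply: teq_sym.
- by move=> /asboolP xy /asboolP yz; apply/asboolP; apply: teq_trans xy yz.
Qed.

Canonical teqb_equiv_rel := EquivRelPack teqb_equiv.
Canonical teqb_encModRel := defaultEncModRel teqb.

Definition tensor := {eq_quot teqb}.
HB.instance Definition _ := EqQuotient.on tensor.
HB.instance Definition _ := Choice.on tensor.

Definition tcls (x : texp) : tensor := \pi x.

Let clsP x y : tcls x = tcls y <-> teq x y.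
Proof. by split=> [/eqmodP/asboolP|xy] //; apply/eqmodP/asboolP. Qed.

Let repr_cls x : teq (repr (tcls x)) x.
Proof. by apply/clsP; rewrite /tcls reprK. Qed.

Let clsW (P : tensor -> Prop) : (forall x, P (tcls x)) -> forall x, P x.
Proof. by move=> Pc x; rewrite -[x]reprK; apply: Pc. Qed.

Definition tens (v : V) (w : W) : tensor := tcls (Tpure v w).
Definition tens_add (x y : tensor) : tensor := tcls (Tadd (repr x) (repr y)).
Definition tens_scale a (x : tensor) : tensor := tcls (Tscale a (repr x)).
Definition tens_zero : tensor := tcls Tzero.
Definition tens_opp := tens_scale (-1).

Let addE x y : tens_add (tcls x) (tcls y) = tcls (Tadd x y).
Proof. by apply/clsP/teq_add; apply: repr_cls. Qed.

Let scaleE a x : tens_scale a (tcls x) = tcls (Tscale a x).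
Proof. by apply/clsP/teq_scale; apply: repr_cls. Qed.

Fact tens_addA : associative tens_add.
Proof.
elim/clsW=> x; elim/clsW=> y; elim/clsW=> z.
by rewrite !addE; apply/clsP/teq_addA.
Qed.

Fact tens_addC : commutative tens_add.
Proof.
by elim/clsW=> x; elim/clsW=> y; rewrite !addE; apply/clsP/teq_addC.
Qed.

Fact tens_add0 : left_id tens_zero tens_add.
Proof.
by elim/clsW=> x; rewrite !addE; apply/clsP/teq_add0.
Qed.

Fact tens_scaleDl (x : tensor) a b :
  tens_scale (a + b) x = tens_add (tens_scale a x) (tens_scale b x).
Proof.
by elim/clsW: x=> x; rewrite !scaleE addE; apply/clsP/teq_scaleDl.
Qed.

Fact tens_scale1 : left_id 1 tens_scale.
Proof. by elim/clsW=> x; rewrite scaleE; apply/clsP/teq_scale1. Qed.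

Fact tens_addN : left_inverse tens_zero tens_opp tens_add.
Proof.
move=> x; rewrite -{2}[x]tens_scale1 -tens_scaleDl addNr.
by elim/clsW: x=> x; rewrite scaleE; apply/clsP/teq_scale0.
Qed.

HB.instance Definition _ :=
  GRing.isZmodule.Build tensor tens_addA tens_addC tens_add0 tens_addN.

Fact tens_scaleA a b x : tens_scale a (tens_scale b x) = tens_scale (a * b) x.
Proof. by elim/clsW: x=> x; rewrite !scaleE; apply/clsP/teq_scaleA. Qed.

Fact tens_scaleDr : right_distributive tens_scale +%R.
Proof.
move=> a; elim/clsW=> x; elim/clsW=> y.
by rewrite -![_ + _]/(tens_add _ _) !(scaleE, addE); apply/clsP/teq_scaleDr.
Qed.

HB.instance Definition _ := GRing.Zmodule_isLmodule.Build K tensor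
  tens_scaleA tens_scale1 tens_scaleDr tens_scaleDl.

Let tclsD x y : tcls x + tcls y = tcls (Tadd x y).
Proof. exact: addE. Qed.

Let tclsZ a x : a *: tcls x = tcls (Tscale a x).
Proof. exact: scaleE. Qed.

Lemma tens_bilinear : bilinear_map tens.
Proof.
split=> [w a v v'|v a w w'] /=; rewrite /tens tclsZ tclsD; apply/clsP.
- exact: teq_linl.
- exact: teq_linr.
Qed.

Lemma tensor_ind (P : tensor -> Prop) :
    (forall v w, P (tens v w)) ->
    (forall a x y, P x -> P y -> P (a *: x + y)) ->
  forall x, P x.
Proof.
move=> Pt Pl.
have P0 : P 0 by rewrite -[0](addNr (tens 0 0)) -scaleN1r; apply: Pl.
elim/clsW; elim=> [|v w|x Px y Py|a x Px] //; first exact: Pt.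
- by rewrite -tclsD -[tcls x]scale1r; apply: Pl.
- by rewrite -tclsZ -[_ *: _]addr0; apply: Pl.
Qed.

Section Lift.
Variables (U : lmodType K) (f : V -> W -> U).

Fixpoint teval (x : texp) : U :=
  match x with
  | Tzero => 0
  | Tpure v w => f v w
  | Tadd x y => teval x + teval y
  | Tscale a x => a *: teval x
  end.

Definition tlift_fun (x : tensor) : U := teval (repr x).

Hypothesis f_bil : bilinear_map f.

Lemma teval_eq x y : teq x y -> teval x = teval y.
Proof.
case: f_bil => fl fr; elim=> //=; intros; rewrite ?(addr0, add0r, scale0r) //;
  rewrite ?(scalerA, scale1r, scalerDr, scalerDl) //; try congruence.
- exact: addrA.
- exact: addrC.
- exact: (fl w).
- exact: (fr v).
Qed.

Let liftE x : tlift_fun (tcls x) = teval x.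
Proof. exact/teval_eq/repr_cls. Qed.

Lemma tlift_linear : linear tlift_fun.
Proof.
by move=> a; elim/clsW=> x; elim/clsW=> y; rewrite tclsZ tclsD !liftE.
Qed.

Definition tlift : {linear tensor -> U} :=
  locked (HB.pack_for {linear tensor -> U} tlift_fun
    (GRing.isLinear.Build K tensor U *:%R tlift_fun tlift_linear)).

Lemma tliftE v w : tlift (tens v w) = f v w.
Proof. by rewrite /tlift -lock; apply: liftE. Qed.

End Lift.

Lemma tensor_ext (U : lmodType K) (f g : {linear tensor -> U}) :
  (forall v w, f (tens v w) = g (tens v w)) -> f =1 g.
Proof.
by move=> fg; elim/tensor_ind=> // a x y fgx fgy; rewrite !linearP fgx fgy.
Qed.

End Tensor.

Notation "V ⨂ W" := (tensor V W).
Notation "v ⊗ w" := (tens v w) : ring_scope.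

Lemma exists_form (K : fieldType) (V : lmodType K) (v : V) :
  v != 0 -> exists f : {linear V -> K^o}, f v = 1.
Proof.
move=> v0.
pose P (A : set V) := (forall a x y, A x -> A y -> A (a *: x + y)) /\ ~ A v.
have [F FP Ftot|A [[Alin Av] Amax]] := @Zorn_bigcup V P.
  split=> [a x y [X FX Xx] [Y FY Yy]|[X FX Xv]]; last by case: (FP _ FX).
  have [XY|YX] := Ftot _ _ FX FY.
  - by exists Y => //; case: (FP _ FY) => + _; apply=> //; apply: XY.
  - by exists X => //; case: (FP _ FX) => + _; apply=> //; apply: YX.
have A0 : A 0.
  have [[x Ax]|A0] := pselect (exists x, A x).
    by rewrite -(addNr x) -scaleN1r; apply: Alin.
  case: (Amax [set 0]).
    split; first by move=> x Ax; case: A0; exists x.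
    by move=> /(_ 0 erefl) Ax; case: A0; exists 0.
  split=> [a x y -> ->|/eqP]; first by rewrite scaler0 addr0.
  by rewrite (negPf v0).
have AZ a x : A x -> A (a *: x) by move=> Ax; rewrite -[_ *: _]addr0; apply: Alin.
have ex x : exists a, A (x - a *: v).
  have [Ax|nAx] := pselect (A x); first by exists 0; rewrite scale0r subr0.
  pose B := [set z | exists y c, A y /\ z = y + c *: x].
  have AB : A `<` B.
    split=> [y Ay|BA]; first by exists y, 0; rewrite scale0r addr0.
    by apply: nAx; apply: BA; exists 0, 1; rewrite scale1r add0r.
  have [y [c [Ay vE]]] : B v.
    apply: contrapT => nBv; apply: (Amax _ AB); split=> //.
    move=> a _ _ [y [c [Ay ->]]] [z [d [Az ->]]].
    exists (a *: y + z), (a * c + d); split; first exact: Alin.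
    by rewrite scalerDr scalerDl scalerA addrACA.
  have c0 : c != 0.
    by apply/negP => /eqP c0; apply: Av; rewrite vE c0 scale0r addr0.
  exists c^-1; rewrite {1}vE scalerDr scalerA mulVf // scale1r opprD addrCA subrr.
  by rewrite addr0 -scalerN -scaleN1r scalerA; apply: AZ.
have uniq x a b : A (x - a *: v) -> A (x - b *: v) -> a = b.
  move=> Aa Ab; apply/eqP; rewrite -subr_eq0; apply/negPn/negP => ab; apply: Av.
  have -> : v = (a - b)^-1 *: ((-1) *: (x - a *: v) + (x - b *: v)).
    rewrite scaleN1r opprB addrA subrK -scalerBl scalerA mulVf ?scale1r //.
  by apply: AZ; apply: Alin.
pose f x : K^o := sval (cid (ex x)).
have fP x : A (x - f x *: v) by rewrite /f; case: cid.
have flin : linear f.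
  move=> a x y; apply: (uniq (a *: x + y)); first exact: fP.
  have := Alin a _ _ (fP x) (fP y).
  by rewrite scalerBr scalerA addrACA -opprD -scalerDl.
exists (HB.pack_for {linear V -> K^o} f (GRing.isLinear.Build K V K^o *:%R f flin)).
by apply: (uniq v); [exact: fP | rewrite scale1r subrr].
Qed.

Section TensorMaps.
Variable K : fieldType.

Lemma tensDl (V W : lmodType K) (v v' : V) (w : W) :
  (v + v') ⊗ w = v ⊗ w + v' ⊗ w.
Proof. by have := (tens_bilinear V W).1 w 1 v v'; rewrite /= !scale1r. Qed.

Lemma tensDr (V W : lmodType K) (v : V) (w w' : W) :
  v ⊗ (w + w') = v ⊗ w + v ⊗ w'.
Proof. by have := (tens_bilinear V W).2 v 1 w w'; rewrite /= !scale1r. Qed.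

Lemma tens0l (V W : lmodType K) (w : W) : (0 : V) ⊗ w = 0.
Proof. by apply: (addrI (0 ⊗ w)); rewrite -tensDl !addr0. Qed.

Lemma tens0r (V W : lmodType K) (v : V) : v ⊗ (0 : W) = 0.
Proof. by apply: (addrI (v ⊗ 0)); rewrite -tensDr !addr0. Qed.

Lemma tensZl (V W : lmodType K) a (v : V) (w : W) : (a *: v) ⊗ w = a *: (v ⊗ w).
Proof.
by have := (tens_bilinear V W).1 w a v 0; rewrite /= !addr0 tens0l addr0.
Qed.

Lemma tensZr (V W : lmodType K) a (v : V) (w : W) : v ⊗ (a *: w) = a *: (v ⊗ w).
Proof.
by have := (tens_bilinear V W).2 v a w 0; rewrite /= !addr0 tens0r addr0.
Qed.

Section Tmap.
Variables (V W V' W' : lmodType K).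
Variables (f : {linear V -> V'}) (g : {linear W -> W'}).

Lemma tmap_bilinear : bilinear_map (fun v w => f v ⊗ g w).
Proof.
by split=> [w a v v'|v a w w'] /=; rewrite linearP ?(tensDl, tensDr)
  ?(tensZl, tensZr).
Qed.

Definition tmap : {linear V ⨂ W -> V' ⨂ W'} := tlift tmap_bilinear.

Lemma tmapE v w : tmap (v ⊗ w) = f v ⊗ g w.
Proof. exact: tliftE. Qed.

End Tmap.

Section Tform.
Variables (V W : lmodType K) (f : {linear V -> K^o}) (g : {linear W -> K^o}).

Lemma tform_bilinear : bilinear_map (fun v w => f v * g w : K^o).
Proof.
split=> [w a v v'|v a w w'] /=; rewrite linearP /=.
- by rewrite mulrDl scalerAl.
- by rewrite mulrDr scalerAr.
Qed.

Definition tform : {linear V ⨂ W -> K^o} := tlift tform_bilinear.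

Lemma tformE v w : tform (v ⊗ w) = f v * g w.
Proof. exact: tliftE. Qed.

End Tform.

Section Tassoc.
Variables U V W : lmodType K.

Lemma tassoc_inner_bilinear (w : W) :
  bilinear_map (fun (u : U) (v : V) => u ⊗ (v ⊗ w)).
Proof.
by split=> [v a u u'|u a v v'] /=; rewrite ?(tensDl, tensZl) ?(tensDr, tensZr).
Qed.

Lemma tassoc_bilinear :
  bilinear_map (fun (x : U ⨂ V) (w : W) => tlift (tassoc_inner_bilinear w) x).
Proof.
split=> [w a x y|x a w w'] /=; first by rewrite linearP.
elim/tensor_ind: x => [u v|b x y]; first by rewrite !tliftE tensDr !(tensDr, tensZr).
by rewrite !linearP /= => -> ->; rewrite !scalerDr !scalerA addrACA.
Qed.

Definition tassoc : {linear (U ⨂ V) ⨂ W -> U ⨂ (V ⨂ W)} := tlift tassoc_bilinear.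

Lemma tassocE u v w : tassoc ((u ⊗ v) ⊗ w) = u ⊗ (v ⊗ w).
Proof. by rewrite /tassoc !tliftE. Qed.

End Tassoc.

Section Tmid.
Variables (V W V' W' X Y : lmodType K) (f : V -> V' -> X) (g : W -> W' -> Y).
Hypotheses (f_bil : bilinear_map f) (g_bil : bilinear_map g).

Lemma tmid_inner_bilinear v w : bilinear_map (fun v' w' => f v v' ⊗ g w w').
Proof.
by split=> [w' a x y|v' a x y] /=; rewrite ?(f_bil.2 v) ?(g_bil.2 w)
  ?(tensDl, tensZl) ?(tensDr, tensZr).
Qed.

Lemma tmid_mid_bilinear (z : V' ⨂ W') :
  bilinear_map (fun v w => tlift (tmid_inner_bilinear v w) z).
Proof.
split=> [w a x y|v a x y] /=; elim/tensor_ind: z => [v' w'|b z t].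
- by rewrite !tliftE (f_bil.1 v') tensDl tensZl.
- by rewrite !linearP /= => -> ->; rewrite !scalerDr !scalerA addrACA.
- by rewrite !tliftE (g_bil.1 w') tensDr tensZr.
- by rewrite !linearP /= => -> ->; rewrite !scalerDr !scalerA addrACA.
Qed.

Lemma tmid_bilinear :
  bilinear_map (fun (x : V ⨂ W) (z : V' ⨂ W') => tlift (tmid_mid_bilinear z) x).
Proof.
split=> [z a x y|x a z t] /=; first by rewrite linearP.
elim/tensor_ind: x => [v w|b x y]; first by rewrite !tliftE linearP.
by rewrite !linearP /= => -> ->; rewrite !scalerDr !scalerA addrACA.
Qed.

(* The linear map (v ⊗ w) ⊗ (v' ⊗ w') |-> f v v' ⊗ g w w'. *)
Definition tmid : {linear (V ⨂ W) ⨂ (V' ⨂ W') -> X ⨂ Y} := tlift tmid_bilinear.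

Lemma tmidE v w v' w' : tmid ((v ⊗ w) ⊗ (v' ⊗ w')) = f v v' ⊗ g w w'.
Proof. by rewrite /tmid !tliftE. Qed.

End Tmid.

Lemma mul_bilinear (A : algType K) : bilinear_map (fun x y : A => x * y).
Proof.
by split=> [y a x x'|x a y y'] /=; rewrite ?mulrDl ?mulrDr -?scalerAl -?scalerAr.
Qed.

End TensorMaps.

Section TensorAlgebra.
Variables (K : fieldType) (A B : algType K).

Definition tens_mul (x y : A ⨂ B) : A ⨂ B :=
  tmid (mul_bilinear A) (mul_bilinear B) (x ⊗ y).

Lemma tens_mulE a b a' b' :
  tens_mul (a ⊗ b) (a' ⊗ b') = (a * a') ⊗ (b * b').
Proof. exact: tmidE. Qed.

Let mulPl a x y z : tens_mul (a *: x + y) z = a *: tens_mul x z + tens_mul y z.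
Proof. by rewrite /tens_mul tensDl tensZl linearP. Qed.

Let mulPr a x y z : tens_mul z (a *: x + y) = a *: tens_mul z x + tens_mul z y.
Proof. by rewrite /tens_mul tensDr tensZr linearP. Qed.

Fact tens_mulA : associative tens_mul.
Proof.
move=> x y z; elim/tensor_ind: x => [a b|k x x' IH IH'].
  elim/tensor_ind: y => [a' b'|k y y' IH IH'].
    elim/tensor_ind: z => [a'' b''|k z z' IH IH'].
      by rewrite !tens_mulE !mulrA.
    by rewrite !mulPr IH IH'.
  by rewrite !(mulPr, mulPl) IH IH'.
by rewrite !mulPl IH IH'.
Qed.

Fact tens_mul1l : left_id (1 ⊗ 1) tens_mul.
Proof.
by elim/tensor_ind=> [a b|k x y xE yE]; rewrite ?tens_mulE ?mul1r // mulPr xE yE.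
Qed.

Fact tens_mul1r : right_id (1 ⊗ 1) tens_mul.
Proof.
by elim/tensor_ind=> [a b|k x y xE yE]; rewrite ?tens_mulE ?mulr1 // mulPl xE yE.
Qed.

Fact tens_mulDl : left_distributive tens_mul +%R.
Proof. by move=> x y z; rewrite -[x]scale1r mulPl !scale1r. Qed.

Fact tens_mulDr : right_distributive tens_mul +%R.
Proof. by move=> x y z; rewrite -[y]scale1r mulPr !scale1r. Qed.

Fact tens_1_neq0 : (1 : A) ⊗ (1 : B) != 0.
Proof.
have [f f1] := exists_form (oner_neq0 A); have [g g1] := exists_form (oner_neq0 B).
apply/eqP => /(congr1 (tform f g)); rewrite tformE f1 g1 linear0 mulr1.
by apply/eqP/oner_neq0.
Qed.

HB.instance Definition _ := GRing.Zmodule_isNzRing.Build (A ⨂ B)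
  tens_mulA tens_mul1l tens_mul1r tens_mulDl tens_mulDr tens_1_neq0.

Lemma tens1E : 1 = 1 ⊗ 1 :> A ⨂ B. Proof. by []. Qed.

Lemma tensM a b a' b' : (a ⊗ b) * (a' ⊗ b') = (a * a') ⊗ (b * b') :> A ⨂ B.
Proof. exact: tens_mulE. Qed.

Fact tens_scalerAl (a : K) (x y : A ⨂ B) : a *: (x * y) = a *: x * y.
Proof.
by have := mulPl a x 0 y; rewrite (mul0r y : tens_mul 0 y = 0) !addr0.
Qed.

HB.instance Definition _ :=
  GRing.Lmodule_isLalgebra.Build K (A ⨂ B) tens_scalerAl.

Fact tens_scalerAr (a : K) (x y : A ⨂ B) : a *: (x * y) = x * (a *: y).
Proof.
by have := mulPr a y 0 x; rewrite (mulr0 x : tens_mul x 0 = 0) !addr0.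
Qed.

HB.instance Definition _ :=
  GRing.Lalgebra_isAlgebra.Build K (A ⨂ B) tens_scalerAr.

End TensorAlgebra.

Section TensorComAlgebra.
Variables (K : fieldType) (A B : comAlgType K).

Fact tens_mulC : commutative (@GRing.mul (A ⨂ B)).
Proof.
move=> x y; elim/tensor_ind: x => [a b|k x x' xE xE'].
  elim/tensor_ind: y => [a' b'|k y y' yE yE']; first by rewrite !tensM !(mulrC a, mulrC b).
  by rewrite mulrDr mulrDl -scalerAl -scalerAr yE yE'.
by rewrite mulrDr mulrDl -scalerAl -scalerAr xE xE'.
Qed.

HB.instance Definition _ := GRing.PzRing_hasCommutativeMul.Build (A ⨂ B) tens_mulC.

End TensorComAlgebra.

Section TensorMorphisms.
Variable K : fieldType.

Lemma tmapM (A B A' B' : algType K) (f : {lrmorphism A -> A'})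
    (g : {lrmorphism B -> B'}) (x y : A ⨂ B) :
  tmap f g (x * y) = tmap f g x * tmap f g y.
Proof.
elim/tensor_ind: x => [a b|k x x' xE xE'].
  elim/tensor_ind: y => [a' b'|k y y' yE yE'].
    by rewrite tensM !tmapE !rmorphM tensM.
  by rewrite mulrDr -scalerAr !linearP /= yE yE' mulrDr -scalerAr.
by rewrite mulrDl -scalerAl !linearP /= xE xE' mulrDl -scalerAl.
Qed.

Lemma tmap1 (A B A' B' : algType K) (f : {lrmorphism A -> A'})
  (g : {lrmorphism B -> B'}) : tmap f g 1 = 1.
Proof. by rewrite tens1E tmapE !rmorph1. Qed.

Lemma tassocM (A B C : algType K) (x y : (A ⨂ B) ⨂ C) :
  tassoc A B C (x * y) = tassoc A B C x * tassoc A B C y.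
Proof.
elim/tensor_ind: x => [u c|k x x' xE xE']; last first.
  by rewrite mulrDl -scalerAl !linearP /= xE xE' mulrDl -scalerAl.
elim/tensor_ind: y => [u' c'|k y y' yE yE']; last first.
  by rewrite mulrDr -scalerAr !linearP /= yE yE' mulrDr -scalerAr.
elim/tensor_ind: u => [a b|k x x' xE xE']; last first.
  by rewrite tensDl tensZl mulrDl -scalerAl !linearP /= xE xE' mulrDl -scalerAl.
elim/tensor_ind: u' => [a' b'|k y y' yE yE']; last first.
  by rewrite tensDl tensZl mulrDr -scalerAr !linearP /= yE yE' mulrDr -scalerAr.
by rewrite !tensM !tassocE !tensM.
Qed.

Definition tmul (A : algType K) : {linear A ⨂ A -> A} := tlift (mul_bilinear A).

Lemma tmulE (A : algType K) (a b : A) : tmul A (a ⊗ b) = a * b.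
Proof. exact: tliftE. Qed.

Lemma tmulM (A : comAlgType K) (x y : A ⨂ A) :
  tmul A (x * y) = tmul A x * tmul A y.
Proof.
elim/tensor_ind: x => [a b|k x x' xE xE'].
  elim/tensor_ind: y => [a' b'|k y y' yE yE'].
    by rewrite tensM !tmulE mulrACA.
  by rewrite mulrDr -scalerAr !linearP /= yE yE' mulrDr -scalerAr.
by rewrite mulrDl -scalerAl !linearP /= xE xE' mulrDl -scalerAl.
Qed.

End TensorMorphisms.

(* The free commutative algebra S(V) on a vector space V, by generators and
   relations: polynomial expressions in the symbols [Sgen v] modulo the laws of
   commutative algebras and the linearity of [Sgen]. *)
Section Sym.
Variables (K : fieldType) (V : lmodType K).

Inductive sexp : Type :=
| Sconst of K
| Sgen of V
| Sadd of sexp & sexp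
| Smul of sexp & sexp.

Inductive symeq : sexp -> sexp -> Prop :=
| symeq_refl x : symeq x x
| symeq_sym x y : symeq x y -> symeq y x
| symeq_trans x y z : symeq x y -> symeq y z -> symeq x z
| symeq_add x x' y y' : symeq x x' -> symeq y y' -> symeq (Sadd x y) (Sadd x' y')
| symeq_mul x x' y y' : symeq x x' -> symeq y y' -> symeq (Smul x y) (Smul x' y')
| symeq_addA x y z : symeq (Sadd x (Sadd y z)) (Sadd (Sadd x y) z)
| symeq_addC x y : symeq (Sadd x y) (Sadd y x)
| symeq_add0 x : symeq (Sadd (Sconst 0) x) x
| symeq_mulA x y z : symeq (Smul x (Smul y z)) (Smul (Smul x y) z)
| symeq_mulC x y : symeq (Smul x y) (Smul y x)
| symeq_mul1 x : symeq (Smul (Sconst 1) x) x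
| symeq_mul0 x : symeq (Smul (Sconst 0) x) (Sconst 0)
| symeq_mulDl x y z : symeq (Smul (Sadd x y) z) (Sadd (Smul x z) (Smul y z))
| symeq_constD a b : symeq (Sconst (a + b)) (Sadd (Sconst a) (Sconst b))
| symeq_constM a b : symeq (Sconst (a * b)) (Smul (Sconst a) (Sconst b))
| symeq_gen a v w :
    symeq (Sgen (a *: v + w)) (Sadd (Smul (Sconst a) (Sgen v)) (Sgen w)).

HB.instance Definition _ := gen_eqMixin sexp.
HB.instance Definition _ := gen_choiceMixin sexp.

Definition symeqb x y := `[< symeq x y >].

Lemma symeqb_equiv : equiv_class_of symeqb.
Proof.
split=> [x|x y|y x z].
- exact/asboolP/symeq_refl.
- by apply/asboolP/asboolP; apply: symeq_sym.
- by move=> /asboolP xy /asboolP yz; apply/asboolP; apply: symeq_trans xy yz.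
Qed.

Canonical symeqb_equiv_rel := EquivRelPack symeqb_equiv.
Canonical symeqb_encModRel := defaultEncModRel symeqb.

Definition sym := {eq_quot symeqb}.
HB.instance Definition _ := EqQuotient.on sym.
HB.instance Definition _ := Choice.on sym.

Definition scls (x : sexp) : sym := \pi x.

Let clsP x y : scls x = scls y <-> symeq x y.
Proof. by split=> [/eqmodP/asboolP|xy] //; apply/eqmodP/asboolP. Qed.

Let repr_cls x : symeq (repr (scls x)) x.
Proof. by apply/clsP; rewrite /scls reprK. Qed.

Let clsW (P : sym -> Prop) : (forall x, P (scls x)) -> forall x, P x.
Proof. by move=> Pc x; rewrite -[x]reprK; apply: Pc. Qed.

Definition sym_const a : sym := scls (Sconst a).
Definition sym_add (x y : sym) : sym := scls (Sadd (repr x) (repr y)).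
Definition sym_mul (x y : sym) : sym := scls (Smul (repr x) (repr y)).
Definition sym_opp := sym_mul (sym_const (-1)).

Let addE x y : sym_add (scls x) (scls y) = scls (Sadd x y).
Proof. by apply/clsP/symeq_add; apply: repr_cls. Qed.

Let mulE x y : sym_mul (scls x) (scls y) = scls (Smul x y).
Proof. by apply/clsP/symeq_mul; apply: repr_cls. Qed.

Fact sym_addA : associative sym_add.
Proof.
elim/clsW=> x; elim/clsW=> y; elim/clsW=> z.
by rewrite !addE; apply/clsP/symeq_addA.
Qed.

Fact sym_addC : commutative sym_add.
Proof. by elim/clsW=> x; elim/clsW=> y; rewrite !addE; apply/clsP/symeq_addC. Qed.

Fact sym_add0 : left_id (sym_const 0) sym_add.
Proof. by elim/clsW=> x; rewrite addE; apply/clsP/symeq_add0. Qed.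

Fact sym_mulA : associative sym_mul.
Proof.
elim/clsW=> x; elim/clsW=> y; elim/clsW=> z.
by rewrite !mulE; apply/clsP/symeq_mulA.
Qed.

Fact sym_mulC : commutative sym_mul.
Proof. by elim/clsW=> x; elim/clsW=> y; rewrite !mulE; apply/clsP/symeq_mulC. Qed.

Fact sym_mul1 : left_id (sym_const 1) sym_mul.
Proof. by elim/clsW=> x; rewrite mulE; apply/clsP/symeq_mul1. Qed.

Fact sym_mulDl : left_distributive sym_mul sym_add.
Proof.
elim/clsW=> x; elim/clsW=> y; elim/clsW=> z.
by rewrite !(mulE, addE); apply/clsP/symeq_mulDl.
Qed.

Fact sym_constD a b : sym_const (a + b) = sym_add (sym_const a) (sym_const b).
Proof. by rewrite addE; apply/clsP/symeq_constD. Qed.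

Fact sym_constM a b : sym_const (a * b) = sym_mul (sym_const a) (sym_const b).
Proof. by rewrite mulE; apply/clsP/symeq_constM. Qed.

Fact sym_addN : left_inverse (sym_const 0) sym_opp sym_add.
Proof.
move=> x; rewrite -{2}[x]sym_mul1 -sym_mulDl -sym_constD addNr.
by elim/clsW: x => x; rewrite mulE; apply/clsP/symeq_mul0.
Qed.

Section Eval.
Variables (A : comAlgType K) (f : {linear V -> A}).

Fixpoint seval (x : sexp) : A :=
  match x with
  | Sconst a => a%:A
  | Sgen v => f v
  | Sadd x y => seval x + seval y
  | Smul x y => seval x * seval y
  end.

Lemma seval_eq x y : symeq x y -> seval x = seval y.
Proof.
elim=> //=; intros; rewrite ?(scale0r, scale1r, add0r, mul1r, mul0r) //;
  try congruence.
- exact: addrA.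
- exact: addrC.
- exact: mulrA.
- exact: mulrC.
- exact: mulrDl.
- exact: scalerDl.
- by rewrite -scalerAl mul1r scalerA.
- by rewrite linearP mulr_algl.
Qed.

End Eval.

Fact sym_1_neq0 : sym_const 1 != sym_const 0.
Proof.
apply/eqP => /clsP /(seval_eq (\0 : {linear V -> K^o})) /=.
by rewrite scale1r scale0r => /eqP; rewrite oner_eq0.
Qed.

HB.instance Definition _ :=
  GRing.isZmodule.Build sym sym_addA sym_addC sym_add0 sym_addN.
HB.instance Definition _ := GRing.Zmodule_isComNzRing.Build sym
  sym_mulA sym_mulC sym_mul1 sym_mulDl sym_1_neq0.

Definition sym_scale a (x : sym) : sym := sym_mul (sym_const a) x.

Fact sym_scaleA a b x : sym_scale a (sym_scale b x) = sym_scale (a * b) x.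
Proof. by rewrite /sym_scale sym_mulA -sym_constM. Qed.

Fact sym_scale1 : left_id 1 sym_scale. Proof. exact: sym_mul1. Qed.

Fact sym_scaleDr : right_distributive sym_scale +%R.
Proof. by move=> a x y; exact: (mulrDr (sym_const a : sym)). Qed.

Fact sym_scaleDl (x : sym) a b :
  sym_scale (a + b) x = sym_scale a x + sym_scale b x.
Proof. by rewrite /sym_scale sym_constD; exact: sym_mulDl. Qed.

HB.instance Definition _ := GRing.Zmodule_isLmodule.Build K sym
  sym_scaleA sym_scale1 sym_scaleDr sym_scaleDl.

Fact sym_scaleAl (a : K) (x y : sym) : a *: (x * y) = a *: x * y.
Proof. exact: sym_mulA. Qed.

HB.instance Definition _ := GRing.Lmodule_isLalgebra.Build K sym sym_scaleAl.
HB.instance Definition _ := GRing.Lalgebra_isComAlgebra.Build K sym.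

Definition sym_gen (v : V) : sym := scls (Sgen v).

Lemma sym_gen_linear : linear sym_gen.
Proof.
move=> a v w.
suff -> : a *: sym_gen v + sym_gen w
    = sym_add (sym_mul (sym_const a) (sym_gen v)) (sym_gen w).
  by rewrite mulE addE; apply/clsP/symeq_gen.
by [].
Qed.

HB.instance Definition _ :=
  GRing.isLinear.Build K V sym *:%R sym_gen sym_gen_linear.

Let constE a : sym_const a = a%:A.
Proof. by rewrite -[a in LHS]mulr1 sym_constM. Qed.

Lemma sym_ind (P : sym -> Prop) :
    (forall a, P a%:A) -> (forall v, P (sym_gen v)) ->
    (forall x y, P x -> P y -> P (x + y)) ->
    (forall x y, P x -> P y -> P (x * y)) ->
  forall x, P x.
Proof.
move=> Pc Pg PD PM; elim/clsW; elim=> [a|v|x Px y Py|x Px y Py].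
- by rewrite -[scls _]/(sym_const a) constE; apply: Pc.
- exact: Pg.
- by rewrite -addE; apply: PD.
- by rewrite -mulE; apply: PM.
Qed.

Section Lift.
Variables (A : comAlgType K) (f : {linear V -> A}).

Definition sym_lift_fun (x : sym) : A := seval f (repr x).

Let liftE x : sym_lift_fun (scls x) = seval f x.
Proof. exact/seval_eq/repr_cls. Qed.

Lemma sym_lift_monoid : monoid_morphism sym_lift_fun.
Proof.
split=> [|x y]; first by rewrite -[1]/(scls _) liftE /= scale1r.
elim/clsW: x => x; elim/clsW: y => y.
by rewrite -[_ * _]/(sym_mul _ _) mulE !liftE.
Qed.

Lemma sym_lift_linear : linear sym_lift_fun.
Proof.
move=> a; elim/clsW=> x; elim/clsW=> y.
have -> : a *: scls x + scls y = scls (Sadd (Smul (Sconst a) x) y).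
  by rewrite -addE -mulE.
by rewrite !liftE /= mulr_algl.
Qed.

Definition sym_lift : {lrmorphism sym -> A} :=
  locked (HB.pack_for {lrmorphism sym -> A} sym_lift_fun
    (GRing.isLinear.Build K sym A *:%R sym_lift_fun sym_lift_linear)
    (GRing.isMonoidMorphism.Build sym A sym_lift_fun sym_lift_monoid)).

Lemma sym_liftE v : sym_lift (sym_gen v) = f v.
Proof. by rewrite /sym_lift -lock; apply: liftE. Qed.

Lemma sym_lift_unique (g : {lrmorphism sym -> A}) :
  (forall v, g (sym_gen v) = f v) -> g =1 sym_lift.
Proof.
move=> gE; elim/sym_ind=> [a|v|x y xE yE|x y xE yE].
- by rewrite !linearZ /= !rmorph1.
- by rewrite gE sym_liftE.
- by rewrite !raddfD /= xE yE.
- by rewrite !rmorphM /= xE yE.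
Qed.

End Lift.

End Sym.

Arguments sym_gen {K V}.

Record hopf_algebra (K : fieldType) (A : algType K) := HopfAlgebra {
  coprod : {lrmorphism A -> A ⨂ A};
  counit : {lrmorphism A -> K^o};
  antipode : {linear A -> A};
  coprodA : forall x : A,
    tassoc A A A (tmap coprod idfun (coprod x)) = tmap idfun coprod (coprod x);
  counitl : forall x : A, tmap counit idfun (coprod x) = 1 ⊗ x;
  counitr : forall x : A, tmap idfun counit (coprod x) = x ⊗ 1;
  antipodel : forall x : A,
    tmul A (tmap antipode idfun (coprod x)) = (counit x)%:A;
  antipoder : forall x : A,
    tmul A (tmap idfun antipode (coprod x)) = (counit x)%:A
}.

Arguments coprod {K A}.
Arguments counit {K A}.
Arguments antipode {K A}.

(* S(V) with the coproduct for which the elements of V are primitive. *)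
Section SymHopf.
Variables (K : fieldType) (V : lmodType K).

Let S := sym V.

Definition sym_prim (v : V) : S ⨂ S := sym_gen v ⊗ 1 + 1 ⊗ sym_gen v.

Lemma sym_prim_linear : linear sym_prim.
Proof.
move=> a v w; rewrite /sym_prim linearP tensDl tensDr tensZl tensZr scalerDr.
by rewrite addrACA.
Qed.

HB.instance Definition _ :=
  GRing.isLinear.Build K V (S ⨂ S) *:%R sym_prim sym_prim_linear.

Definition sym_coprod : {lrmorphism S -> S ⨂ S} := sym_lift sym_prim.
Definition sym_counit : {lrmorphism S -> K^o} :=
  sym_lift (\0 : {linear V -> K^o}).
Definition sym_antipode : {lrmorphism S -> S} := sym_lift (\- sym_gen).

Lemma sym_coprod_gen v :
  sym_coprod (sym_gen v) = sym_gen v ⊗ 1 + 1 ⊗ sym_gen v.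
Proof. exact: sym_liftE. Qed.

Let coprod_gen v :
  (sym_coprod : {linear S -> S ⨂ S}) (sym_gen v) = sym_gen v ⊗ 1 + 1 ⊗ sym_gen v.
Proof. exact: sym_coprod_gen. Qed.
Let counit_gen v : (sym_counit : {linear S -> K^o}) (sym_gen v) = 0.
Proof. exact: sym_liftE. Qed.
Let antipode_gen v : (sym_antipode : {linear S -> S}) (sym_gen v) = - sym_gen v.
Proof. exact: sym_liftE. Qed.

Lemma sym_coprodA x :
  tassoc S S S (tmap sym_coprod idfun (sym_coprod x)) =
  tmap idfun sym_coprod (sym_coprod x).
Proof.
elim/sym_ind: x => [a|v|x y xE yE|x y xE yE].
- by rewrite !linearZ /= !rmorph1 !tens1E !tmapE !rmorph1 !tens1E tassocE.
- rewrite sym_coprod_gen !linearD /= !tmapE !rmorph1 !coprod_gen.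
  by rewrite tensDl tensDr !linearD /= !tens1E !tassocE addrA.
- by rewrite !linearD /= xE yE.
- by rewrite rmorphM !tmapM tassocM xE yE.
Qed.

Lemma sym_counitl x : tmap sym_counit idfun (sym_coprod x) = 1 ⊗ x.
Proof.
elim/sym_ind: x => [a|v|x y xE yE|x y xE yE].
- by rewrite !linearZ /= !rmorph1 tens1E tmapE !rmorph1 tensZr.
- by rewrite sym_coprod_gen linearD /= !tmapE counit_gen tens0l add0r rmorph1.
- by rewrite !linearD /= xE yE tensDr.
- by rewrite rmorphM tmapM xE yE tensM mulr1.
Qed.

Lemma sym_counitr x : tmap idfun sym_counit (sym_coprod x) = x ⊗ 1.
Proof.
elim/sym_ind: x => [a|v|x y xE yE|x y xE yE].
- by rewrite !linearZ /= !rmorph1 tens1E tmapE !rmorph1 tensZl.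
- by rewrite sym_coprod_gen linearD /= !tmapE counit_gen tens0r addr0 rmorph1.
- by rewrite !linearD /= xE yE tensDl.
- by rewrite rmorphM tmapM xE yE tensM mulr1.
Qed.

Lemma sym_antipodel x :
  tmul S (tmap sym_antipode idfun (sym_coprod x)) = (sym_counit x)%:A.
Proof.
elim/sym_ind: x => [a|v|x y xE yE|x y xE yE].
- by rewrite !linearZ /= !rmorph1 tens1E tmapE tmulE !rmorph1 mulr1 (mulr1 a : a *: (1 : K^o) = a).
- rewrite sym_coprod_gen !linearD /= !tmapE !tmulE antipode_gen counit_gen !rmorph1.
  by rewrite mulr1 mul1r addNr scale0r.
- by rewrite !linearD /= xE yE scalerDl.
- by rewrite !rmorphM tmapM tmulM xE yE /= -scalerAl mul1r scalerA.
Qed.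

Lemma sym_antipoder x :
  tmul S (tmap idfun sym_antipode (sym_coprod x)) = (sym_counit x)%:A.
Proof.
elim/sym_ind: x => [a|v|x y xE yE|x y xE yE].
- by rewrite !linearZ /= !rmorph1 tens1E tmapE tmulE !rmorph1 mulr1 (mulr1 a : a *: (1 : K^o) = a).
- rewrite sym_coprod_gen !linearD /= !tmapE !tmulE antipode_gen counit_gen !rmorph1.
  by rewrite mulr1 mul1r addrN scale0r.
- by rewrite !linearD /= xE yE scalerDl.
- by rewrite !rmorphM tmapM tmulM xE yE /= -scalerAl mul1r scalerA.
Qed.

Definition sym_hopf : hopf_algebra S :=
  HopfAlgebra sym_coprodA sym_counitl sym_counitr sym_antipodel sym_antipoder.

End SymHopf.

(* m^{1,3} : (A ⊗ H) ⊗ (A ⊗ H) -> A ⊗ (H ⊗ H). *)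
Definition m13 (K : fieldType) (A H : algType K) :
    {linear (A ⨂ H) ⨂ (A ⨂ H) -> A ⨂ (H ⨂ H)} :=
  tmid (mul_bilinear A) (tens_bilinear H H).

Lemma m13E (K : fieldType) (A H : algType K) (a c : A) (b d : H) :
  m13 A H ((a ⊗ b) ⊗ (c ⊗ d)) = (a * c) ⊗ (b ⊗ d).
Proof. exact: tmidE. Qed.

(* Compatibility of [rho] with the Hopf algebra structure of H. As it only uses
   the algebra structure of A, the coproduct of A does not occur, and [rho] is
   not required to be coassociative. *)
Definition cointeraction (K : fieldType) (A H : algType K)
    (hA : hopf_algebra A) (hH : hopf_algebra H) (rho : {linear H -> A ⨂ H}) : Prop :=
  [/\ rho 1 = 1 ⊗ 1,
      forall x y, rho (x * y) = rho x * rho y,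
      forall x, tmap idfun (counit hH) (rho x) = 1 ⊗ (counit hH x) &
      forall x, tmap idfun (coprod hH) (rho x) =
                m13 A H (tmap rho rho (coprod hH x))].

Section Span.
Variables (K : fieldType) (V : lmodType K).

Definition lspan (G : set V) : set V :=
  [set x | exists2 s : seq (K * V),
     (forall p, p \in s -> G p.2) & x = \sum_(p <- s) p.1 *: p.2].

Lemma lspan_closed (G : set V) a x y :
  lspan G x -> lspan G y -> lspan G (a *: x + y).
Proof.
move=> [s sG ->] [t tG ->]; exists ([seq (a * p.1, p.2) | p <- s] ++ t).
  by move=> p; rewrite mem_cat => /orP[/mapP[q /sG Gq ->]|/tG].
rewrite big_cat big_map /= scaler_sumr.
by congr (_ + _); apply: eq_bigr => p _; rewrite scalerA.
Qed.

Lemma lspan0 (G : set V) : lspan G 0.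
Proof. by exists [::] => //; rewrite big_nil. Qed.

Lemma lspan_gen (G : set V) x : G x -> lspan G x.
Proof.
move=> Gx; exists [:: (1, x)]; last by rewrite big_seq1 scale1r.
by move=> p; rewrite inE => /eqP ->.
Qed.

End Span.

(* The quotient module V/W; the library's [Quotient.quot W] is only a Z-module. *)
Section QuotModule.
Variables (K : fieldType) (V : lmodType K) (W : submodClosed V).

Definition quot_pred : {pred V} := [pred x | x \in W].

HB.instance Definition _ :=
  GRing.isZmodClosed.Build V quot_pred (GRing.submod_closedB (submodClosedP W)).

Definition quot_mod := Quotient.quot quot_pred.
HB.instance Definition _ := EqQuotient.on quot_mod.
HB.instance Definition _ := GRing.Zmodule.on quot_mod.

Definition quot_cls (x : V) : quot_mod := \pi x.
Definition quot_scale a (x : quot_mod) : quot_mod := quot_cls (a *: repr x).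

Lemma quot_clsP x y : quot_cls x = quot_cls y <-> x - y \in W.
Proof.
rewrite /quot_cls -[_ \in W]/(x - y \in quot_pred) Quotient.idealrBE.
by split=> [->|/eqP //]; apply: eqxx.
Qed.

Let clsZ a x : quot_scale a (quot_cls x) = quot_cls (a *: x).
Proof.
apply/quot_clsP; rewrite -scalerBr rpredZ //.
by apply/quot_clsP; rewrite /quot_cls reprK.
Qed.

Let clsD x y : quot_cls (x + y) = quot_cls x + quot_cls y.
Proof. exact: Quotient.pi_add. Qed.

Let clsW (P : quot_mod -> Prop) : (forall x, P (quot_cls x)) -> forall x, P x.
Proof. by move=> Pc x; rewrite -[x]reprK; apply: Pc. Qed.

Fact quot_scaleA a b x : quot_scale a (quot_scale b x) = quot_scale (a * b) x.
Proof. by elim/clsW: x => x; rewrite !clsZ scalerA. Qed.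

Fact quot_scale1 : left_id 1 quot_scale.
Proof. by elim/clsW => x; rewrite clsZ scale1r. Qed.

Fact quot_scaleDr : right_distributive quot_scale +%R.
Proof.
by move=> a; elim/clsW=> x; elim/clsW=> y; rewrite -clsD !clsZ -clsD scalerDr.
Qed.

Fact quot_scaleDl (x : quot_mod) a b :
  quot_scale (a + b) x = quot_scale a x + quot_scale b x.
Proof. by elim/clsW: x => x; rewrite !clsZ -clsD scalerDl. Qed.

HB.instance Definition _ := GRing.Zmodule_isLmodule.Build K quot_mod
  quot_scaleA quot_scale1 quot_scaleDr quot_scaleDl.

Lemma quot_cls_linear : linear quot_cls.
Proof. by move=> a x y; rewrite clsD -clsZ. Qed.

HB.instance Definition _ :=
  GRing.isLinear.Build K V quot_mod *:%R quot_cls quot_cls_linear.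

Section Lift.
Variables (U : lmodType K) (f : {linear V -> U}).

Definition quot_lift_fun (x : quot_mod) : U := f (repr x).

Hypothesis f0 : forall x, x \in W -> f x = 0.

Let liftE x : quot_lift_fun (quot_cls x) = f x.
Proof.
apply/eqP; rewrite -subr_eq0 -linearB; apply/eqP/f0.
by apply/quot_clsP; rewrite /quot_cls reprK.
Qed.

Lemma quot_lift_linear : linear quot_lift_fun.
Proof.
move=> a; elim/clsW=> x; elim/clsW=> y.
by rewrite -quot_cls_linear !liftE linearP.
Qed.

Definition quot_lift : {linear quot_mod -> U} :=
  locked (HB.pack_for {linear quot_mod -> U} quot_lift_fun
    (GRing.isLinear.Build K quot_mod U *:%R quot_lift_fun quot_lift_linear)).

Lemma quot_liftE x : quot_lift (quot_cls x) = f x.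
Proof. by rewrite /quot_lift -lock; apply: liftE. Qed.

End Lift.

End QuotModule.

(* The indecomposables ker ε / (ker ε ⊙ ker ε). *)
Section Indecomposables.
Variables (K : fieldType) (H : algType K) (h : hopf_algebra H).

Definition aug_pred : {pred H} := [pred x | counit h x == 0].

Fact aug_pred_closed : submod_closed aug_pred.
Proof.
split=> [|a x y]; rewrite ?inE ?linear0 ?eqxx //.
by move=> /eqP x0 /eqP y0; rewrite linearP /= x0 y0 addr0 scaler0.
Qed.

HB.instance Definition _ := GRing.isSubmodClosed.Build K H aug_pred aug_pred_closed.

Record aug := Aug { aug_val : H; augP : aug_val \in aug_pred }.

HB.instance Definition _ := [isSub for aug_val].
HB.instance Definition _ := [Choice of aug by <:].
HB.instance Definition _ := [SubChoice_isSubLmodule of aug by <:].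

Fact aug_val_linear : linear aug_val.
Proof. exact: (linearP (val : {linear aug -> H})). Qed.

HB.instance Definition _ :=
  GRing.isLinear.Build K aug H *:%R aug_val aug_val_linear.

(* ker ε ⊙ ker ε *)
Definition aug_square : set H :=
  lspan [set z | exists x y : aug, z = aug_val x * aug_val y].

Definition decomp_pred : {pred aug} := [pred x : aug | `[< aug_square (aug_val x) >]].

Fact decomp_pred_closed : submod_closed decomp_pred.
Proof.
split=> [|a x y]; first by apply/asboolP; rewrite linear0; apply: lspan0.
move=> /asboolP sx /asboolP sy; apply/asboolP.
by rewrite linearP; apply: lspan_closed.
Qed.

HB.instance Definition _ :=
  GRing.isSubmodClosed.Build K aug decomp_pred decomp_pred_closed.

Definition indec := quot_mod decomp_pred.
HB.instance Definition _ := GRing.Lmodule.on indec.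

Definition indec_cls : {linear aug -> indec} := @quot_cls K aug decomp_pred.

(* Primitive elements of the completed dual. *)
Definition is_infinitesimal (f : {linear H -> K^o}) : Prop :=
  f 1 = 0 /\ forall x, aug_square x -> f x = 0.

Record infchar := InfChar {
  infchar_form :> {linear H -> K^o};
  infcharP : is_infinitesimal infchar_form
}.

Lemma infchar_indec_subproof (v : infchar) (x : aug) :
  x \in decomp_pred -> (v \o aug_val) x = 0.
Proof. by move=> /asboolP xsq; apply: (infcharP v).2. Qed.

(* The linear form on the indecomposables induced by [v]. *)
Definition infchar_indec (v : infchar) : {linear indec -> K^o} :=
  quot_lift (@infchar_indec_subproof v).

Lemma infchar_indecE (v : infchar) (x : aug) :
  infchar_indec v (indec_cls x) = v (aug_val x).
Proof. exact: quot_liftE. Qed.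

End Indecomposables.

Section CombinatorialHopf.
Variables (R : realType) (H : algType R).

Definition primitive (h : hopf_algebra H) : set H :=
  [set x | coprod h x = x ⊗ 1 + 1 ⊗ x].

Record is_graded (h : hopf_algebra H) (G : nat -> set H) : Prop := IsGraded {
  grade0 : forall n, G n 0;
  gradeP : forall n a x y, G n x -> G n y -> G n (a *: x + y);
  grade_direct : forall x, exists! f : nat -> H, (forall n, G n (f n)) /\
    exists N, (forall n, (N <= n)%N -> f n = 0) /\ x = \sum_(n < N) f n;
  grade1 : G 0%N 1;
  gradeM : forall m n x y, G m x -> G n y -> G (m + n)%N (x * y);
  grade_coprod : forall n x, G n x ->
    lspan [set z | exists k l a b, [/\ (k + l = n)%N, G k a, G l b & z = a ⊗ b]]
      (coprod h x);
  grade_counit : forall n x, G n x -> n <> 0%N -> counit h x = 0;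
  grade_antipode : forall n x, G n x -> G n (antipode h x)
}.

Record comb_hopf_algebra := CombHopfAlgebra {
  comb_hopf :> hopf_algebra H;
  grade : nat -> set H;
  (* [basis n] lists the elements of B_n. *)
  basis : nat -> seq H;
  comb_graded : is_graded comb_hopf grade;
  comb_connected : forall x, grade 0 x -> exists! a : R, x = a%:A;
  basis_grade : forall n x, x \in basis n -> grade n x;
  basis_coord : forall n x, grade n x ->
    exists! c : {ffun 'I_(size (basis n)) -> R}, x = \sum_i c i *: (basis n)`_i;
  basis_growth : exists b c : R,
    [/\ 0 < b, 0 < c & forall n, (size (basis n))%:R <= b * c ^+ n];
  basis_mul : forall m n x y, x \in basis m -> y \in basis n ->
    exists c : 'I_(size (basis (m + n))) -> nat,
      x * y = \sum_i (c i)%:R *: (basis (m + n))`_i;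
  basis_coprod : forall n x, x \in basis n ->
    exists c : nat -> nat -> nat -> nat,
      coprod comb_hopf x =
      \sum_(k < n.+1) \sum_(i < size (basis k)) \sum_(j < size (basis (n - k)))
         (c k i j)%:R *: ((basis k)`_i ⊗ (basis (n - k))`_j)
}.

End CombinatorialHopf.

Arguments grade {R H}.
Arguments basis {R H}.

Section Substitution.
Variables (R : realType) (H : algType R) (C : comb_hopf_algebra H).

Definition is_nondegenerate : Prop :=
  [set x | exists n, x \in basis C n] `&` primitive C = [set` basis C 1].

Let n1 := size (basis C 1).

(* The element e_i of the basis of the graded dual that is dual to the basis of
   H, where e_i = (basis C 1)`_i. *)
Lemma dual_gen_exists (i : 'I_n1) : exists f : {linear H -> R^o},
  forall n (j : 'I_(size (basis C n))),
    f (basis C n)`_j = ((n == 1%N) && (j == i :> nat))%:R.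
Proof.
have gr := comb_graded C.
pose dec x := cid (grade_direct gr x).
have decP x : (forall n, grade C n (sval (dec x) n)) /\
    exists N, (forall n, (N <= n)%N -> sval (dec x) n = 0) /\
      x = \sum_(n < N) sval (dec x) n by case: (dec x) => f [].
have dec_uniq x f : (forall n, grade C n (f n)) -> (exists N,
    (forall n, (N <= n)%N -> f n = 0) /\ x = \sum_(n < N) f n) ->
    sval (dec x) = f.
  by move=> fG fN; case: (dec x) => g [] _ /=; apply.
have sum_widen N M (f : nat -> H) : (N <= M)%N ->
    (forall n, (N <= n)%N -> f n = 0) -> \sum_(n < N) f n = \sum_(n < M) f n.
  move=> NM f0; rewrite -(subnKC NM) big_split_ord /= [X in _ = _ + X]big1 ?addr0 //.
  by move=> k _; apply: f0; apply: leq_addr.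
have dec_lin a x y n : sval (dec (a *: x + y)) n = a *: sval (dec x) n + sval (dec y) n.
  rewrite (dec_uniq _ (fun n => a *: sval (dec x) n + sval (dec y) n)) //.
    by move=> m; apply: (gradeP gr); [case: (decP x) | case: (decP y)].
  have [_ [N [N0 xE]]] := decP x; have [_ [M [M0 yE]]] := decP y.
  exists (maxn N M); split=> [k|].
    by rewrite geq_max => /andP[/N0-> /M0->]; rewrite scaler0 addr0.
  rewrite big_split -scaler_sumr /= -(sum_widen _ _ _ (leq_maxl N M)) //.
  by rewrite -(sum_widen _ _ _ (leq_maxr N M)) // -xE -yE.
pose co x := cid (basis_coord ((decP x).1 1%N)).
have coP x : sval (dec x) 1%N = \sum_i sval (co x) i *: (basis C 1)`_i.
  by case: (co x) => c [].
have co_uniq x (c : {ffun 'I_n1 -> R}) :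
    sval (dec x) 1%N = \sum_i c i *: (basis C 1)`_i -> sval (co x) = c.
  by move=> cE; case: (co x) => d [] _ /=; apply.
pose f x : R^o := sval (co x) i.
have flin : linear f.
  move=> a x y; rewrite /f (co_uniq _ [ffun j => a * sval (co x) j + sval (co y) j]).
    by rewrite ffunE.
  rewrite dec_lin; move: (coP x) (coP y).
  move: (sval (co x)) (sval (co y)) => cx cy -> ->.
  rewrite scaler_sumr -big_split; apply: eq_bigr => j _ /=.
  by rewrite ffunE scalerDl scalerA.
exists (HB.pack_for {linear H -> R^o} f (GRing.isLinear.Build R H R^o *:%R f flin)).
move=> n j /=; rewrite /f.
have bj : grade C n (basis C n)`_j by apply/basis_grade/mem_nth.
have decj : sval (dec (basis C n)`_j) =
    fun m => if m == n then (basis C n)`_j else 0.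
  apply: dec_uniq => [m|]; first by case: eqP => [->|_] //; apply: (grade0 gr).
  exists n.+1; split=> [m|]; first by case: eqP => [->|//]; rewrite ltnn.
  rewrite (bigD1 ord_max) //= eqxx big1 ?addr0 // => k.
  by rewrite -val_eqE /= => /negPf ->.
rewrite (co_uniq _ [ffun k : 'I_n1 => ((n == 1%N) && (j == k :> nat))%:R]) ?ffunE //.
rewrite decj eq_sym; have [n_eq1|_] := eqVneq n 1%N; last first.
  by rewrite big1 // => k _; rewrite ffunE scale0r.
have j_lt : (j < n1)%N by have := ltn_ord j; rewrite /n1 -n_eq1.
rewrite (bigD1 (Ordinal j_lt)) //= ffunE /= eqxx scale1r.
rewrite big1 => [|k].
  by rewrite addr0; apply: (congr1 (fun m => (basis C m)`_j) n_eq1).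
rewrite -val_eqE /= ffunE eq_sym => /negPf ->.
by rewrite scale0r.
Qed.

Definition dual_gen (i : 'I_n1) : {linear H -> R^o} :=
  sval (cid (dual_gen_exists i)).

(* The convolution product of linear forms. *)
Definition conv (f g : {linear H -> R^o}) : {linear H -> R^o} :=
  tform f g \o coprod C.

Definition is_character (f : {linear H -> R^o}) : Prop :=
  f 1 = 1 /\ forall x y, f (x * y) = f x * f y.

Record is_rough_path (gamma : R) (X : R -> R -> {linear H -> R^o}) : Prop :=
  IsRoughPath {
    rough_character : forall s t, is_character (X s t);
    rough_chen : forall s u t, conv (X s u) (X u t) =1 X s t;
    rough_bound : forall n x, x \in basis C n ->
      has_ubound [set r | exists s t : R, s != t /\
        r = `|X s t x| / `|t - s| `^ (gamma * n%:R)]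
  }.

(* The sum over i of H_in, the component i being the set of pairs (w, e_i). *)
Definition indec_gens := {ffun 'I_n1 -> indec C}.
HB.instance Definition _ := GRing.Lmodule.on indec_gens.

Definition indec_pair (w : indec C) (i : 'I_n1) : indec_gens :=
  [ffun j => if j == i then w else 0].

Definition prim_tuple := 'I_n1 -> infchar C.

Definition prim_tuple_form (v : prim_tuple) (g : indec_gens) : R^o :=
  \sum_i infchar_indec (v i) (g i).

Fact prim_tuple_form_linear v : linear (prim_tuple_form v).
Proof.
move=> a x y; rewrite /prim_tuple_form scaler_sumr -big_split.
by apply: eq_bigr => i _; rewrite !ffunE linearP.
Qed.

HB.instance Definition _ v := GRing.isLinear.Build R indec_gens R^o *:%R
  (prim_tuple_form v) (prim_tuple_form_linear v).

(* e^v *)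
Definition exp_char (v : prim_tuple) : {lrmorphism sym indec_gens -> R^o} :=
  sym_lift (prim_tuple_form v).

Lemma exp_charE v w i :
  exp_char v (sym_gen (indec_pair w i)) = infchar_indec (v i) w.
Proof.
rewrite /exp_char sym_liftE /= /prim_tuple_form (bigD1 i) //= ffunE eqxx.
by rewrite big1 ?addr0 // => j /negPf ji; rewrite ffunE ji linear0.
Qed.

Definition coaction_of
    (S : prim_tuple -> {linear H -> R^o} -> {linear H -> R^o})
    (rho : {linear H -> sym indec_gens ⨂ H}) : Prop :=
  forall v (chi : {linear H -> R^o}) x,
    S v chi x = tform (exp_char v) chi (rho x).

Record is_substitution (gamma : R)
    (S : prim_tuple -> {linear H -> R^o} -> {linear H -> R^o}) : Prop :=
  IsSubstitution {
    (* each S_v is a unital algebra morphism; the unit for * is the counit *)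
    subst_linear : forall v a (chi psi : {linear H -> R^o}),
      S v (a \*: chi \+ psi) =1 a \*: S v chi \+ S v psi;
    subst_unit : forall v, S v (counit C) =1 counit C;
    subst_conv : forall v chi psi, S v (conv chi psi) =1 conv (S v chi) (S v psi);
    subst_gen : forall v i, S v (dual_gen i) =1 v i;
    (* [w] is the tuple S_v(u), whose components are primitive *)
    subst_comp : forall v u : prim_tuple, exists w : prim_tuple,
      (forall i, S v (u i) =1 w i) /\ (forall chi, S v (S u chi) =1 S w chi);
    subst_character : forall v chi, is_character chi -> is_character (S v chi);
    subst_rough : forall v X,
      is_rough_path gamma X -> is_rough_path gamma (fun s t => S v (X s t));
    subst_coaction : exists rho, coaction_of S rho
  }.

End Substitution.

Arguments is_nondegenerate {R H}.

(* Main.v *)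
Require Import Defs.
From HB Require Import structures.
From mathcomp Require Import all_boot all_order all_algebra all_reals.
From mathcomp Require Import boolp classical_sets zify generic_quotient.

(* The forms e^v ⊗ χ, with v a tuple of primitive elements and χ a character of
   H, are characters of S ⊗ H, and pairing them with ρ gives S_v(χ).  So the
   algebra identities for ρ hold once tested against all of them, and those with
   ε and Δ follow likewise from S_v(ε) = ε and S_v(χ * ψ) = S_v(χ) * S_v(ψ),
   where χ and ψ may be arbitrary linear forms.  It remains to see that these
   forms separate points.
   For S, a form can be prescribed freely on linearly independent generators, and
   a polynomial vanishing everywhere is zero.
   For H, let Z be the common kernel of the characters.  Given an infinitesimal
   character f, the derivation D_f = (id ⊗ f) Δ is locally nilpotent and
   χ ∘ exp(t D_f) is a character for all t, so D_f preserves Z; as it lowers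
   degrees, we may assume by induction that D_f x = 0 for all f.  If Y is the
   grading derivation and a the antipode, the forms f = g ∘ (a * Y) are
   infinitesimal, and id * (a * Y) = Y, so that Y x = 0 and x is a constant,
   which the counit detects. *)

Set Implicit Arguments.
Unset Strict Implicit.
Unset Printing Implicit Defensive.

Import GRing.Theory Num.Theory.
Local Open Scope ring_scope.

(** * Separating families of linear forms and tensor products *)

Section Separation.
Variable K : fieldType.

Definition separating {V : lmodType K} (F : {linear V -> K^o} -> Prop) :=
  forall x, (forall f, F f -> f x = 0) -> x = 0.

Lemma separating_eq (V : lmodType K) (F : {linear V -> K^o} -> Prop) x y :
  separating F -> (forall f, F f -> f x = f y) -> x = y.
Proof.
move=> sepF fE; apply/eqP; rewrite -subr_eq0; apply/eqP/sepF => f Ff.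
by rewrite linearB /= fE // subrr.
Qed.

Lemma separating_all (V : lmodType K) : separating (fun _ : {linear V -> K^o} => True).
Proof.
move=> x fx; apply/eqP/negPn/negP => /exists_form[f f1].
by have /eqP := fx f I; rewrite f1 oner_eq0.
Qed.

Section Contraction.
Variables (V W : lmodType K).

Lemma contract_left_bilinear (f : {linear V -> K^o}) :
  bilinear_map (fun (v : V) (w : W) => f v *: w).
Proof.
split=> [w a v v'|v a w w'] /=; first by rewrite linearP /= scalerDl scalerA.
by rewrite scalerDr !scalerA mulrC.
Qed.

Lemma contract_right_bilinear (g : {linear W -> K^o}) :
  bilinear_map (fun (v : V) (w : W) => g w *: v).
Proof.
split=> [w a v v'|v a w w'] /=; last by rewrite linearP /= scalerDl scalerA.
by rewrite scalerDr !scalerA mulrC.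
Qed.

Definition contract_left f : {linear V ⨂ W -> W} := tlift (contract_left_bilinear f).
Definition contract_right g : {linear V ⨂ W -> V} := tlift (contract_right_bilinear g).

Lemma contract_leftE f v w : contract_left f (v ⊗ w) = f v *: w.
Proof. exact: tliftE. Qed.

Lemma contract_rightE g v w : contract_right g (v ⊗ w) = g w *: v.
Proof. exact: tliftE. Qed.

Lemma tform_left f g x : tform f g x = g (contract_left f x).
Proof.
elim/tensor_ind: x => [v w|a x y]; last by rewrite !linearP /= => -> ->.
by rewrite tformE contract_leftE linearZ.
Qed.

Lemma tform_right f g x : tform f g x = f (contract_right g x).
Proof.
elim/tensor_ind: x => [v w|a x y]; last by rewrite !linearP /= => -> ->.
by rewrite tformE contract_rightE linearZ mulrC.
Qed.

Lemma tensor_sum (x : V ⨂ W) :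
  exists s : seq (V * W), x = \sum_(p <- s) p.1 ⊗ p.2.
Proof.
elim/tensor_ind: x => [v w|a x y [s ->] [t ->]].
  by exists [:: (v, w)]; rewrite big_seq1.
exists ([seq (a *: p.1, p.2) | p <- s] ++ t).
rewrite big_cat big_map scaler_sumr; congr (_ + _).
by apply: eq_bigr => p _; rewrite tensZl.
Qed.

(** Induction on the number of pure tensors in [x]: a first term with [w = 0] is dropped, any other
    one is absorbed into the remaining terms. *)
Lemma contract_right_eq0 (x : V ⨂ W) :
  (forall g, contract_right g x = 0) -> x = 0.
Proof.
have [s xE] := tensor_sum x.
have [n] := ubnP (size s); elim: n s xE => // n IHn [|[v w] s] xE sn x0.
  by rewrite xE big_nil.
move: sn; rewrite ltnS /= => sn.
have [w0|/exists_form[g gw]] := eqVneq w 0.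
  by apply: (IHn s) => //; rewrite xE big_cons /= w0 tens0r add0r.
have := x0 g; rewrite [in contract_right _ _]xE linear_sum big_cons /=.
rewrite contract_rightE gw scale1r.
(* the vanishing of the contraction expresses v through the other terms *)
move/eqP; rewrite addr_eq0 => /eqP vE.
apply: (IHn [seq (p.1, p.2 - g p.2 *: w) | p <- s]) => //; last by rewrite size_map.
rewrite xE big_cons /= vE big_map /= -scaleN1r tensZl scaleN1r.
have tens_suml (I : Type) (r : seq I) (F : I -> V) :
    (\sum_(i <- r) F i) ⊗ w = \sum_(i <- r) F i ⊗ w.
  by elim: r => [|i r IHr]; rewrite ?big_nil ?tens0l // !big_cons tensDl IHr.
rewrite tens_suml -sumrN -big_split; apply: eq_bigr => p _ /=.
by rewrite tensDr -scaleNr tensZr contract_rightE tensZl scaleNr addrC.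
Qed.

(** For [f] in [F], the contraction of [x] by [f] is killed by all of [G], hence is 0. So [F] kills
    the contraction of [x] by an arbitrary form on [W]. *)
Lemma separating_tensor F G : separating F -> separating G ->
  separating (fun h : {linear V ⨂ W -> K^o} =>
    exists f g, [/\ F f, G g & h = tform f g]).
Proof.
move=> sepF sepG x hx; apply: contract_right_eq0 => g.
apply: sepF => f Ff; rewrite -tform_right tform_left.
suff -> : contract_left f x = 0 by rewrite linear0.
apply: sepG => g' Gg'; rewrite -tform_left.
by apply: hx; exists f, g'.
Qed.

End Contraction.
End Separation.

Arguments contract_left {K V W}.
Arguments contract_right {K V W}.

(** * Multiplicative forms on the symmetric algebra *)

Lemma poly_horner_eq0 (K : numFieldType) (p : {poly K}) :
  (forall t, p.[t] = 0) -> p = 0.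
Proof.
move=> p0; apply/eqP/negPn/negP => /max_poly_roots.
(* In characteristic 0 the integers below [size p] are distinct, which makes one root too many. *)
move=> /(_ [seq n%:R | n <- iota 0 (size p)]); rewrite size_map size_iota ltnn.
have -> : all (root p) [seq n%:R | n <- iota 0 (size p)].
  by apply/allP => t _; rewrite /root p0.
have -> : uniq [seq (n%:R : K) | n <- iota 0 (size p)].
  by rewrite map_inj_uniq ?iota_uniq // => m n /eqP; rewrite eqr_nat => /eqP.
by move=> /(_ isT isT).
Qed.

Section SymSeparation.
Variables (K : numFieldType) (V : lmodType K).

(** An element of S(V) involves finitely many generators; recording a list of them permits induction
    on its length. *)
Inductive in_alg_gen (s : seq V) : sym V -> Prop :=
| in_alg_const a : in_alg_gen s a%:A
| in_alg_gen_mem v : v \in s -> in_alg_gen s (sym_gen v)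
| in_alg_add x y : in_alg_gen s x -> in_alg_gen s y -> in_alg_gen s (x + y)
| in_alg_mul x y : in_alg_gen s x -> in_alg_gen s y -> in_alg_gen s (x * y).

Lemma in_alg_trans s t x : (forall v, v \in s -> in_alg_gen t (sym_gen v)) ->
  in_alg_gen s x -> in_alg_gen t x.
Proof. by move=> st; elim; eauto using in_alg_gen. Qed.

Lemma in_alg_exists x : exists s, in_alg_gen s x.
Proof.
have cat s t x' y' : in_alg_gen s x' -> in_alg_gen t y' ->
    in_alg_gen (s ++ t) x' /\ in_alg_gen (s ++ t) y'.
  by move=> sx ty; split; [apply: in_alg_trans sx | apply: in_alg_trans ty] => v vs;
    apply: in_alg_gen_mem; rewrite mem_cat vs ?orbT.
elim/sym_ind: x => [a|v|x y [s sx] [t ty]|x y [s sx] [t ty]].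
- by exists [::]; apply: in_alg_const.
- by exists [:: v]; apply: in_alg_gen_mem; rewrite mem_seq1.
- by have [? ?] := cat _ _ _ _ sx ty; exists (s ++ t); apply: in_alg_add.
- by have [? ?] := cat _ _ _ _ sx ty; exists (s ++ t); apply: in_alg_mul.
Qed.

Lemma in_alg_nil x : in_alg_gen [::] x -> exists a, x = a%:A.
Proof.
elim=> [a|//|_ _ _ [a ->] _ [b ->]|_ _ _ [a ->] _ [b ->]]; first by exists a.
  by exists (a + b); rewrite scalerDl.
by exists (a * b); rewrite -scalerAl mul1r scalerA.
Qed.

(** Sorting by powers of [w] isolates the effect on [x] of changing the value of a form at [w]
    alone. *)
Lemma in_alg_cons w s x : in_alg_gen (w :: s) x ->
  exists2 p : {poly sym V}, forall k, in_alg_gen s p`_k & x = p.[sym_gen w].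
Proof.
have c0 : in_alg_gen s 0 by rewrite -(scale0r 1); apply: in_alg_const.
have c1 : in_alg_gen s 1 by rewrite -(scale1r 1); apply: in_alg_const.
elim=> [a|v|_ _ _ [p pP ->] _ [q qP ->]|_ _ _ [p pP ->] _ [q qP ->]].
- exists (a%:A)%:P; last by rewrite hornerC.
  by move=> k; rewrite coefC; case: ifP => _ //; apply: in_alg_const.
- rewrite in_cons => /orP[/eqP->|vs].
    exists 'X; last by rewrite hornerX.
    by move=> k; rewrite coefX; case: (k == 1%N).
  exists (sym_gen v)%:P; last by rewrite hornerC.
  by move=> k; rewrite coefC; case: ifP => _ //; apply: in_alg_gen_mem.
- by exists (p + q) => [k|]; rewrite ?hornerD // coefD; apply: in_alg_add.
- exists (p * q) => [k|]; last by rewrite hornerM.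
  by rewrite coefM; elim/big_ind: _ => // *; [apply: in_alg_add|apply: in_alg_mul].
Qed.

(** Induction on the number of generators. With [x] written as a polynomial in one generator [w],
    letting the value at [w] range over [K] shows that the forms kill each coefficient, and the
    coefficients involve one generator less. *)
Lemma separating_sym :
  separating (fun f : {linear sym V -> K^o} =>
    exists l : {linear V -> K^o}, f = sym_lift l).
Proof.
move=> x fx; have {fx} lx (l : {linear V -> K^o}) : sym_lift l x = 0.
  exact: (fx (sym_lift l) (ex_intro _ l erefl)).
have [s sx] := in_alg_exists x.
have [n] := ubnP (size s); elim: n => // n IHn in s x sx lx *.
case: s sx => [|w s] sx /=.
  have [a xa] := in_alg_nil sx; have := lx \0.
  rewrite xa linearZ /= rmorph1 => /eqP; rewrite [_ *: _]mulr1 => /eqP ->.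
  by rewrite scale0r.
rewrite ltnS => sn.
have [w0|/exists_form[g gw]] := eqVneq w 0.
  apply: IHn sn => //; apply: in_alg_trans sx => v; rewrite in_cons => /orP[/eqP->|vs].
    by rewrite w0 linear0 -(scale0r 1); apply: in_alg_const.
  exact: in_alg_gen_mem.
(* Once [g] kills the other generators, the value of a form at [w] can be
   changed freely. *)
pose s' := [seq v - g v *: w | v <- s].
have /in_alg_cons[p pP xE] : in_alg_gen (w :: s') x.
  apply: in_alg_trans sx => v; rewrite in_cons => /orP[/eqP->|vs].
    by apply: in_alg_gen_mem; rewrite mem_head.
  have -> : sym_gen v = sym_gen (v - g v *: w) + (g v)%:A * sym_gen w.
    by rewrite linearB linearZ /= mulr_algl subrK.
  apply: in_alg_add; last apply: in_alg_mul.
  - apply: in_alg_gen_mem; rewrite in_cons; apply/orP; right.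
    by apply/mapP; exists v.
  - exact: in_alg_const.
  - by apply: in_alg_gen_mem; rewrite mem_head.
suff p0 : p = 0 by rewrite xE p0 horner0.
apply/polyP => k; rewrite coef0; apply: (IHn s'); rewrite ?size_map //.
move=> l.
suff /polyP/(_ k) : map_poly (sym_lift l) p = 0 by rewrite coef0 coef_map.
apply: poly_horner_eq0 => t.
(* As [g w = 1], this form takes the value [t] at [w]; on [s'], which [g] kills, it agrees with
   [l]. *)
pose lt : {linear V -> K^o} := l \+ (t - l w) \*: g.
have ltE y : in_alg_gen s' y -> sym_lift lt y = sym_lift l y.
  elim=> [a|v /mapP[u _ ->]|y1 y2 _ IH1 _ IH2|y1 y2 _ IH1 _ IH2].
  - by rewrite !linearZ /= !rmorph1.
  - have g0 : g (u - g u *: w) = 0.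
      by rewrite linearB linearZ /= gw [_ *: _]mulr1 subrr.
    by rewrite !sym_liftE /= g0 scaler0 addr0.
  - by rewrite !linearD /= IH1 IH2.
  - by rewrite !rmorphM /= IH1 IH2.
have := lx lt; rewrite xE -horner_map /= sym_liftE /= gw [_ *: 1]mulr1 addrC subrK => <-.
congr _.[_]; apply/polyP => i.
by rewrite !coef_map /= ltE.
Qed.

End SymSeparation.

(** * Antipode, derivations and the operator a * Y in a commutative Hopf algebra *)

Section TensorFunctor.
Variable K : fieldType.

Lemma tmap_comp (V V' V'' W W' W'' : lmodType K)
    (f' : {linear V' -> V''}) (f : {linear V -> V'})
    (g' : {linear W' -> W''}) (g : {linear W -> W'}) z :
  tmap f' g' (tmap f g z) = tmap (f' \o f) (g' \o g) z.
Proof.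
elim/tensor_ind: z => [v w|k x y]; first by rewrite !tmapE.
by rewrite !linearP /= => -> ->.
Qed.

Lemma eq_tmap (V V' W W' : lmodType K)
    (f f' : {linear V -> V'}) (g g' : {linear W -> W'}) :
  f =1 f' -> g =1 g' -> tmap f g =1 tmap f' g'.
Proof. by move=> ff' gg'; apply: tensor_ext => v w; rewrite !tmapE ff' gg'. Qed.

End TensorFunctor.

Lemma derivation1 (A : nzRingType) (D : A -> A) :
  (forall x y, D (x * y) = D x * y + x * D y) -> D 1 = 0.
Proof.
move=> DM; have := DM 1 1; rewrite !mulr1 mul1r => /eqP.
by rewrite -subr_eq0 opprD addrA subrr sub0r oppr_eq0 => /eqP.
Qed.

Section HopfFacts.
Variables (K : fieldType) (A : comAlgType K) (h : hopf_algebra A).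
Implicit Types x y : A.

Lemma counitlE x : contract_left (counit h) (coprod h x) = x.
Proof.
have := congr1 (contract_left (idfun : {linear K^o -> K^o})) (counitl h x).
rewrite contract_leftE /= scale1r => {2}<-.
elim/tensor_ind: (coprod h x) => [a b|k u v]; last by rewrite !linearP /= => -> ->.
by rewrite tmapE !contract_leftE.
Qed.

Lemma counitrE x : contract_right (counit h) (coprod h x) = x.
Proof.
have := congr1 (contract_right (idfun : {linear K^o -> K^o})) (counitr h x).
rewrite contract_rightE /= scale1r => {2}<-.
elim/tensor_ind: (coprod h x) => [a b|k u v]; last by rewrite !linearP /= => -> ->.
by rewrite tmapE !contract_rightE.
Qed.

Lemma tmap_counit_coprod (f : {linear A -> A}) x :
  (forall y, f y = (counit h y)%:A) -> tmap f idfun (coprod h x) = 1 ⊗ x.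
Proof.
move=> fE; rewrite -[in RHS](counitlE x).
elim/tensor_ind: (coprod h x) => [a b|k u v].
  by rewrite tmapE fE contract_leftE tensZl tensZr.
by rewrite !linearP tensDr tensZr /= => -> ->.
Qed.

Lemma tens1l_mul_bilinear :
  bilinear_map (fun (a : A) (z : A ⨂ A) => (a ⊗ 1) * z : A ⨂ A).
Proof.
split=> [z a u v|a k u v] /=; first by rewrite tensDl tensZl mulrDl scalerAl.
by rewrite mulrDr scalerAr.
Qed.

(** On pure tensors this is a ⊗ (b ⊗ c) ↦ ab ⊗ c. *)
Definition mull : {linear A ⨂ (A ⨂ A) -> A ⨂ A} := tlift tens1l_mul_bilinear.

Lemma mullE a z : mull (a ⊗ z) = (a ⊗ 1) * z.
Proof. exact: tliftE. Qed.

Lemma mull_tassoc (f g : {linear A -> A}) z :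
  mull (tmap f (tmap g idfun) (tassoc A A A z)) =
  tmap (tmul A \o tmap f g) idfun z.
Proof.
elim/tensor_ind: z => [u c|k x y]; last by rewrite !linearP /= => -> ->.
elim/tensor_ind: u => [a b|k x y]; last first.
  by rewrite !(tensDl, tensZl) !linearP /= => -> ->.
by rewrite tassocE !tmapE mullE tensM mul1r /= tmapE tmulE.
Qed.

(* As A is commutative this is an algebra morphism, hence so is its inverse;
   that is how the antipode is seen to be multiplicative. *)
Definition galois_map : {linear A ⨂ A -> A ⨂ A} := mull \o tmap idfun (coprod h).

(** In Sweedler notation x ⊗ y ↦ x a(y_1) ⊗ y_2, to be compared with x ⊗ y ↦ x y_1 ⊗ y_2 for
    [galois_map]. *)
Definition galois_inv : {linear A ⨂ A -> A ⨂ A} :=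
  mull \o tmap idfun (tmap (antipode h) idfun) \o tmap idfun (coprod h).

Lemma galois_mapE x y : galois_map (x ⊗ y) = (x ⊗ 1) * coprod h y.
Proof. by rewrite /galois_map /= tmapE mullE. Qed.

Lemma galois_invE x y :
  galois_inv (x ⊗ y) = (x ⊗ 1) * tmap (antipode h) idfun (coprod h y).
Proof. by rewrite /galois_inv /= !tmapE mullE. Qed.

Lemma galois_mapM u v : galois_map (u * v) = galois_map u * galois_map v.
Proof.
elim/tensor_ind: u => [a b|k x x' xE xE']; last first.
  by rewrite mulrDl -scalerAl !linearP xE xE' mulrDl -scalerAl.
elim/tensor_ind: v => [c d|k y y' yE yE']; last first.
  by rewrite mulrDr -scalerAr !linearP yE yE' mulrDr -scalerAr.
by rewrite tensM !galois_mapE rmorphM mulrACA tensM mulr1.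
Qed.

Lemma galois_inv_mull x z : galois_inv ((x ⊗ 1) * z) = (x ⊗ 1) * galois_inv z.
Proof.
elim/tensor_ind: z => [a b|k u v uE vE]; last first.
  by rewrite mulrDr -scalerAr !linearP uE vE mulrDr -scalerAr.
by rewrite tensM mul1r !galois_invE mulrA tensM mulr1.
Qed.

(** By coassociativity the left side is x_1 a(x_2) ⊗ x_3, which collapses by the antipode axiom and
    then the counit axiom. *)
Lemma galois_inv_coprod x : galois_inv (coprod h x) = 1 ⊗ x.
Proof.
rewrite /galois_inv /= -coprodA mull_tassoc tmap_comp.
transitivity (tmap (tmul A \o tmap idfun (antipode h) \o coprod h) idfun (coprod h x)).
  exact: eq_tmap.
by apply: tmap_counit_coprod; apply: antipoder.
Qed.

Lemma galois_mapK : cancel galois_map galois_inv.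
Proof.
elim/tensor_ind=> [x y|k u v uE vE]; last by rewrite !linearP uE vE.
by rewrite galois_mapE galois_inv_mull galois_inv_coprod tensM mulr1 mul1r.
Qed.

Lemma galois_map_antipode x :
  galois_map (tmap (antipode h) idfun (coprod h x)) = 1 ⊗ x.
Proof.
rewrite /galois_map /= tmap_comp.
(* The identity of A ⊗ A is written as [tmap idfun idfun] to fit the shape of [mull_tassoc]. *)
transitivity (mull (tmap (antipode h) (tmap idfun idfun)
  (tmap idfun (coprod h) (coprod h x)))).
  rewrite tmap_comp; congr (mull _); apply: eq_tmap => // y /=.
  elim/tensor_ind: (coprod h y) => [a b|k u v uE vE]; first by rewrite tmapE.
  by rewrite linearP -uE -vE.
rewrite -coprodA mull_tassoc tmap_comp.
transitivity (tmap (tmul A \o tmap (antipode h) idfun \o coprod h) idfun (coprod h x)).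
  exact: eq_tmap.
by apply: tmap_counit_coprod; apply: antipodel.
Qed.

(** Both sides have the image 1 ⊗ xy under [galois_map], which is injective and multiplicative. *)
Lemma tmap_antipodeM x y :
  tmap (antipode h) idfun (coprod h (x * y)) =
  tmap (antipode h) idfun (coprod h x) * tmap (antipode h) idfun (coprod h y).
Proof.
apply: (can_inj galois_mapK).
by rewrite galois_mapM !galois_map_antipode tensM mulr1.
Qed.

(** The Leibniz form of the notion of infinitesimal character. *)
Definition is_eps_derivation (f : {linear A -> K^o}) :=
  forall x y, f (x * y) = f x * counit h y + counit h x * f y.

Section Derivation.
Variable f : {linear A -> K^o}.

Definition right_der : {linear A -> A} := contract_right f \o coprod h.

Hypothesis fD : is_eps_derivation f.

Lemma contract_right_derM (u v : A ⨂ A) :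
  contract_right f (u * v) = contract_right f u * contract_right (counit h) v +
                             contract_right (counit h) u * contract_right f v.
Proof.
elim/tensor_ind: u => [a b|k u u' uE uE']; last first.
  rewrite mulrDl -scalerAl !linearP uE uE' !mulrDl -!scalerAl !scalerDr.
  by rewrite addrACA.
elim/tensor_ind: v => [c d|k v v' vE vE']; last first.
  rewrite mulrDr -scalerAr !linearP vE vE' !mulrDr -!scalerAr !scalerDr.
  by rewrite addrACA.
rewrite tensM !contract_rightE fD scalerDl.
by rewrite -!scalerAl -!scalerAr !scalerA.
Qed.

Lemma right_derM x y : right_der (x * y) = right_der x * y + x * right_der y.
Proof.
by rewrite /right_der /= rmorphM contract_right_derM !counitrE.
Qed.

Lemma eps_derivation1 : f 1 = 0.
Proof.
have := fD 1 1; rewrite mulr1 rmorph1 mulr1 mul1r => /eqP.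
by rewrite -subr_eq0 opprD addrA subrr sub0r oppr_eq0 => /eqP.
Qed.

End Derivation.

Section EulerMap.
Variable Y : {linear A -> A}.
Hypothesis YM : forall x y, Y (x * y) = Y x * y + x * Y y.

(** The convolution product a * Y, known as the Dynkin operator when [Y] is the grading
    derivation. *)
Definition euler_map : {linear A -> A} :=
  tmul A \o tmap (antipode h) Y \o coprod h.

Let delta : {linear A ⨂ A -> A} := tmul A \o tmap idfun Y.

Let euler_mapE x : euler_map x = delta (tmap (antipode h) idfun (coprod h x)).
Proof. by rewrite /euler_map /delta /= tmap_comp; congr (tmul A _); apply: eq_tmap. Qed.

Let deltaM u v : delta (u * v) = delta u * tmul A v + tmul A u * delta v.
Proof.
elim/tensor_ind: u => [a b|k u u' uE uE']; last first.
  rewrite mulrDl -scalerAl !linearP uE uE' !mulrDl -!scalerAl !scalerDr.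
  by rewrite addrACA.
elim/tensor_ind: v => [c d|k v v' vE vE']; last first.
  rewrite mulrDr -scalerAr !linearP vE vE' !mulrDr -!scalerAr !scalerDr.
  by rewrite addrACA.
rewrite tensM /delta /= !tmapE !tmulE /= YM mulrDr.
by rewrite [X in X + _ = _]mulrACA [X in _ + X = _]mulrACA.
Qed.

(** By [tmap_antipodeM] the argument of [delta] is multiplicative, and [tmul] sends it to the
    counit. Hence any linear form composed with [euler_map] is an infinitesimal character. *)
Lemma euler_mapM x y :
  euler_map (x * y) = counit h y *: euler_map x + counit h x *: euler_map y.
Proof.
rewrite !euler_mapE tmap_antipodeM deltaM !antipodel.
by rewrite [_ * _%:A]mulrC !mulr_algl.
Qed.

(** Formally id * (a * Y) = (id * a) * Y = Y; the regrouping is done by [galois_inv], which sends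
    Δ(x) to 1 ⊗ x. *)
Lemma id_conv_euler x : tmul A (tmap idfun euler_map (coprod h x)) = Y x.
Proof.
have deltaE z : tmul A (tmap idfun euler_map z) = delta (galois_inv z).
  elim/tensor_ind: z => [a b|k u v]; last by rewrite !linearP /= => -> ->.
  rewrite tmapE tmulE euler_mapE galois_invE deltaM.
  rewrite /delta /= tmapE !tmulE mulr1.
  by rewrite (derivation1 YM) mulr0 mul0r add0r.
by rewrite deltaE galois_inv_coprod /delta /= tmapE tmulE mul1r.
Qed.

End EulerMap.
End HopfFacts.

(** * Exponentials of locally nilpotent derivations *)

Section Flow.
Variables (K : numFieldType) (A : algType K) (D : {linear A -> A}).
Hypothesis DM : forall x y, D (x * y) = D x * y + x * D y.
Hypothesis D_nilp : forall x, exists n, iter n D x == 0.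
Variable chi : {linear A -> K^o}.
Hypothesis chi1 : chi 1 = 1.
Hypothesis chiM : forall x y, chi (x * y) = chi x * chi y.

(* t |-> chi (exp (t D) x) *)
Definition flow_poly x : {poly K} :=
  \poly_(k < ex_minn (D_nilp x)) ((chi (iter k D x) : K) / k`!%:R).

Lemma iter_linear k a x y :
  iter k D (a *: x + y) = a *: iter k D x + iter k D y.
Proof. by elim: k => //= k ->; rewrite linearP. Qed.

(** The formula also holds beyond the degree bound, where [iter k D x] is already 0. *)
Lemma coef_flow x k : (flow_poly x)`_k = (chi (iter k D x) : K) / k`!%:R.
Proof.
rewrite coef_poly; case: ex_minnP => n /eqP nx _; case: ltnP => // nk.
rewrite -(subnK nk) iterD nx.
have -> : iter (k - n) D 0 = 0 by elim: (k - n)%N => //= m ->; rewrite linear0.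
by rewrite linear0 mul0r.
Qed.

Lemma flow_linear a x y : flow_poly (a *: x + y) = a *: flow_poly x + flow_poly y.
Proof.
apply/polyP => k; rewrite coefD coefZ !coef_flow iter_linear linearP mulrDl.
by rewrite mulrA.
Qed.

Lemma deriv_flow x : (flow_poly x)^`() = flow_poly (D x).
Proof.
apply/polyP => k; rewrite coef_deriv !coef_flow -iterSr factS natrM invfM.
by rewrite mulrA -[LHS]mulr_natr mulrAC divfK ?pnatr_eq0.
Qed.

(** The constant terms agree because [chi] is multiplicative. The Leibniz rule expresses both
    derivatives through products of the same kind, and in characteristic 0 a coefficient is
    recovered from that of the derivative one index lower. *)
Lemma flow_mul x y : flow_poly (x * y) = flow_poly x * flow_poly y.
Proof.
apply/polyP => k; elim: k x y => [|k IHk] x y.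
  by rewrite coef0M !coef_flow /= !divr1 chiM.
have deriv_coef (p : {poly K}) : p`_k.+1 = p^`()`_k / k.+1%:R.
  by rewrite coef_deriv -[X in X / _]mulr_natr mulfK ?pnatr_eq0.
rewrite !deriv_coef derivM !deriv_flow DM -[D x * y]scale1r flow_linear scale1r.
by rewrite !coefD !IHk.
Qed.

Lemma flow_horner_linear t : linear (fun x => (flow_poly x).[t] : K^o).
Proof. by move=> a x y; rewrite flow_linear hornerD hornerZ. Qed.

Definition flow_char t : {linear A -> K^o} :=
  HB.pack_for {linear A -> K^o} (fun x => (flow_poly x).[t] : K^o)
    (GRing.isLinear.Build K A K^o *:%R _ (flow_horner_linear t)).

Lemma flow_charM t x y : flow_char t (x * y) = flow_char t x * flow_char t y.
Proof. by rewrite /= flow_mul hornerM. Qed.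

Lemma flow_char1 t : flow_char t 1 = 1.
Proof.
have D1 := derivation1 DM.
rewrite /=; suff -> : flow_poly 1 = 1 by rewrite hornerC.
apply/polyP => -[|k]; rewrite coef_flow coef1 /= ?chi1 ?divr1 //.
have -> : D (iter k D 1) = 0.
  by rewrite -iterS iterSr D1; elim: k => //= k ->; rewrite linear0.
by rewrite linear0 mul0r.
Qed.

(** A polynomial in [t] that vanishes everywhere has linear coefficient 0. *)
Lemma flow_char0 x : (forall t, flow_char t x = 0) -> chi (D x) = 0.
Proof.
move=> /poly_horner_eq0 /(congr1 (fun p : {poly K} => p`_1)).
by rewrite coef_flow coef0 [_ / _]divr1.
Qed.

End Flow.

(** * The grading derivation *)

Section Grading.
Variables (R : realType) (H : algType R) (h : hopf_algebra H) (G : nat -> set H).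
Hypothesis gr : is_graded h G.

Lemma grade_sum x :
  exists N (f : nat -> H), (forall n, G n (f n)) /\ x = \sum_(n < N) f n.
Proof. by have [f [[fG [N [_ xE]]] _]] := grade_direct gr x; exists N, f. Qed.

Lemma grade_bilinear_ext (V : lmodType R) (f g : H -> H -> V) :
  bilinear_map f -> bilinear_map g ->
  (forall m n x y, G m x -> G n y -> f x y = g x y) -> forall x y, f x y = g x y.
Proof.
move=> fb gb fg x y; rewrite -(tliftE fb) -(tliftE gb).
have [M [c [cG ->]]] := grade_sum x; have [N [d [dG ->]]] := grade_sum y.
have expand : (\sum_(m < M) c m) ⊗ (\sum_(n < N) d n) =
    \sum_(m < M) \sum_(n < N) c m ⊗ d n :> H ⨂ H.
  elim/big_ind2: _ => [|u u' v v' <- <-|m _]; [exact: tens0l|exact: tensDl|].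
  by elim/big_ind2: _ => [|u u' v v' <- <-|n _]; [exact: tens0r|exact: tensDr|].
rewrite expand !linear_sum; apply: eq_bigr => m _.
rewrite !linear_sum; apply: eq_bigr => n _.
by rewrite !tliftE; apply: fg (cG m) (dG n).
Qed.

Lemma grade_uniq (f : nat -> H) N : (forall n, G n (f n)) ->
  \sum_(n < N) f n = 0 -> forall n, (n < N)%N -> f n = 0.
Proof.
move=> fG f0 n nN; have [c [_ c_uniq]] := grade_direct gr 0.
have trunc0 : c = fun=> 0.
  apply: c_uniq; split=> [m|]; first exact: (grade0 gr).
  by exists 0%N; split=> //; rewrite big_ord0.
(* Decompositions have finite support, whereas [f] is arbitrary from [N] on; hence the cut. *)
have : c = fun m => if (m < N)%N then f m else 0.
  apply: c_uniq; split=> [m|]; first by case: ifP => // _; apply: (grade0 gr).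
  exists N; split=> [m|]; first by rewrite ltnNge => ->.
  by rewrite -[LHS]f0; apply: eq_bigr => m _; rewrite ltn_ord.
by rewrite trunc0 => /(congr1 (fun g => g n)); rewrite nN.
Qed.

Lemma grading_operator :
  exists Y : {linear H -> H}, forall n x, G n x -> Y x = n%:R *: x.
Proof.
pose dec x := cid (grade_direct gr x).
pose c x := sval (dec x).
have c_fin x : exists N, (forall n, (N <= n)%N -> c x n = 0) /\ x = \sum_(n < N) c x n.
  by rewrite /c; case: (dec x) => f [[]].
pose N x := sval (cid (c_fin x)).
pose Y x := \sum_(n < N x) n%:R *: c x n.
(* By uniqueness of components, [Y x] can be computed from any homogeneous decomposition, whatever
   its length. *)
have YE M (f : nat -> H) x : (forall n, G n (f n)) -> x = \sum_(n < M) f n ->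
    Y x = \sum_(n < M) n%:R *: f n.
  move=> fG xE; rewrite /Y /N; case: cid => L [L0 xL] /=.
  have cf : c x = fun n => if (n < M)%N then f n else 0.
    rewrite /c; case: (dec x) => g [_ g_uniq] /=; apply: g_uniq; split=> [m|].
      by case: ifP => // _; apply: (grade0 gr).
    exists M; split=> [m|]; first by rewrite ltnNge => ->.
    by rewrite xE; apply: eq_bigr => m _; rewrite ltn_ord.
  transitivity (\sum_(0 <= n < maxn L M) n%:R *: c x n).
    rewrite -(big_mkord xpredT (fun n => n%:R *: c x n)).
    rewrite [RHS](big_cat_nat (leq0n L) (leq_maxl L M)) /= [X in _ + X]big1_seq ?addr0 //.
    by move=> n /=; rewrite mem_index_iota => /andP[/L0 -> _]; rewrite scaler0.
  rewrite (big_cat_nat (leq0n M) (leq_maxr L M)) /= [X in _ + X]big1_seq ?addr0.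
    by rewrite big_mkord; apply: eq_bigr => n _; rewrite cf ltn_ord.
  move=> n /=; rewrite mem_index_iota => /andP[Mn _].
  by rewrite cf ltnNge Mn scaler0.
have Ylin : linear Y.
  move=> a x y.
  have [M [f [fG xE]]] := grade_sum x; have [L [g [gG yE]]] := grade_sum y.
  (* Padding by zeros brings the decompositions of [x] and [y] to a common length. *)
  pose cut k (u : nat -> H) n := if (n < k)%N then u n else 0.
  have cutG k (u : nat -> H) n : (forall m, G m (u m)) -> G n (cut k u n).
    by move=> uG; rewrite /cut; case: ifP => // _; apply: (grade0 gr).
  have cut_sum k (u : nat -> H) : (k <= maxn M L)%N ->
      \sum_(n < k) u n = \sum_(n < maxn M L) cut k u n.
    move=> kM; rewrite -(big_mkord xpredT u) -(big_mkord xpredT (cut k u)).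
    rewrite [RHS](big_cat_nat (leq0n k) kM) /= [X in _ + X]big1_seq ?addr0.
      by apply: eq_big_nat => n /andP[_ nk]; rewrite /cut nk.
    by move=> n /=; rewrite mem_index_iota /cut => /andP[kn _]; rewrite ltnNge kn.
  rewrite (cut_sum _ _ (leq_maxl M L)) in xE.
  rewrite (cut_sum _ _ (leq_maxr M L)) in yE.
  rewrite (YE _ _ _ _ xE) => [|n]; last exact: cutG.
  rewrite (YE _ _ _ _ yE) => [|n]; last exact: cutG.
  rewrite (YE (maxn M L) (fun n => a *: cut M f n + cut L g n)).
  - rewrite scaler_sumr -big_split; apply: eq_bigr => n _.
    by rewrite /= scalerDr !scalerA mulrC.
  - by move=> n; apply: (gradeP gr); apply: cutG.
  - by rewrite big_split -scaler_sumr /= -xE -yE.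
exists (HB.pack_for {linear H -> H} Y (GRing.isLinear.Build R H H *:%R Y Ylin)).
move=> n x xG /=; rewrite (YE n.+1 (fun m => if m == n then x else 0)).
- rewrite big_ord_recr /= eqxx big1 ?add0r // => m _.
  by rewrite ltn_eqF // scaler0.
- by move=> m; case: eqP => [->//|_]; apply: (grade0 gr).
- rewrite big_ord_recr /= eqxx big1 ?add0r // => m _.
  by rewrite ltn_eqF.
Qed.

Section Operator.
Variable Y : {linear H -> H}.
Hypothesis YE : forall n x, G n x -> Y x = n%:R *: x.

Lemma grading_operatorM x y : Y (x * y) = Y x * y + x * Y y.
Proof.
apply: (@grade_bilinear_ext _ (fun x y => Y (x * y)) (fun x y => Y x * y + x * Y y)).
- split=> [v a u u'|v a u u'] /=; first by rewrite mulrDl -scalerAl linearP.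
  by rewrite mulrDr -scalerAr linearP.
- split=> [v a u u'|v a u u'] /=.
    by rewrite linearP !mulrDl -!scalerAl /= scalerDr addrACA.
  by rewrite linearP !mulrDr -!scalerAr /= scalerDr addrACA.
move=> m n u v uG vG; rewrite (YE (gradeM gr uG vG)) (YE uG) (YE vG).
by rewrite -scalerAl -scalerAr -scalerDl natrD.
Qed.

(** The component of degree n is multiplied by n, which is invertible for n > 0. *)
Lemma grading_operator_ker x : Y x = 0 -> G 0%N x.
Proof.
have [N [f [fG ->]]] := grade_sum x; rewrite linear_sum => Y0.
have {}Y0 : \sum_(n < N) n%:R *: f n = 0.
  by rewrite -[RHS]Y0; apply: eq_bigr => n _; rewrite (YE (fG n)).
have GZ n a z : G n z -> G n (a *: z).
  by move=> zG; rewrite -[_ *: z]addr0; apply: (gradeP gr) (grade0 gr n).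
have f0 n : (0 < n < N)%N -> f n = 0.
  move=> /andP[n0 nN]; have /eqP := grade_uniq (fun m => GZ m m%:R _ (fG m)) Y0 nN.
  by rewrite scaler_eq0 pnatr_eq0 -leqn0 leqNgt n0 => /eqP.
case: N f0 {Y0} => [|N] f0; first by rewrite big_ord0; apply: (grade0 gr).
rewrite big_ord_recl big1 ?addr0 // => n _.
by apply: f0; rewrite /= /bump /= add1n ltnS.
Qed.

End Operator.
End Grading.

(** * Separation of points by characters *)

Section CharactersSeparate.
Variables (R : realType) (H : comAlgType R) (h : hopf_algebra H) (G : nat -> set H).
Hypothesis gr : is_graded h G.
Hypothesis connected : forall x, G 0%N x -> exists a : R, x = a%:A.

Definition degree_lt n x :=
  exists f : nat -> H, (forall m, G m (f m)) /\ x = \sum_(m < n) f m.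

Lemma degree_ltP n a x y : degree_lt n x -> degree_lt n y -> degree_lt n (a *: x + y).
Proof.
move=> [f [fG ->]] [g [gG ->]]; exists (fun m => a *: f m + g m).
by split=> [m|]; [apply: (gradeP gr)|rewrite big_split -scaler_sumr].
Qed.

Lemma degree_lt0 n : degree_lt n 0.
Proof. by exists (fun=> 0); split=> [m|]; [apply: (grade0 gr)|rewrite big1]. Qed.

Lemma grade_degree_lt k n x : (k < n)%N -> G k x -> degree_lt n x.
Proof.
move=> kn xG; exists (fun m => if m == k then x else 0); split=> [m|].
  by case: eqP => [->//|_]; apply: (grade0 gr).
rewrite (bigD1 (Ordinal kn)) //= eqxx big1 ?addr0 // => m.
by rewrite -val_eqE /= => /negPf ->.
Qed.

(** A term a ⊗ b of the coproduct contributes f(b) a. If a has degree at least [n], then b has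
    degree 0, so it is a scalar by connectedness and [f] kills it. *)
Lemma right_der_degree (f : {linear H -> R^o}) n x : f 1 = 0 ->
  degree_lt n.+1 x -> degree_lt n (right_der h f x).
Proof.
move=> f1 [g [gG ->]]; rewrite linear_sum.
have dlD u v : degree_lt n u -> degree_lt n v -> degree_lt n (u + v).
  by rewrite -[u in u + v]scale1r; apply: degree_ltP.
have dlZ a u : degree_lt n u -> degree_lt n (a *: u).
  by rewrite -[_ *: u]addr0 => ?; apply: degree_ltP => //; apply: degree_lt0.
elim/big_ind: _ => [|//|m _]; first exact: degree_lt0.
have [s sP] := grade_coprod gr (gG m).
rewrite /right_der /= => ->; rewrite linear_sum big_seq.
elim/big_ind: _ => [|//|p /sP[k [l [a [b [kl aG bG ->]]]]]]; first exact: degree_lt0.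
rewrite linearZ /= contract_rightE; apply: (dlZ).
have [k_lt|k_ge] := ltnP k n; first by apply/dlZ/(grade_degree_lt k_lt).
have l0 : l = 0%N by have := ltn_ord m; rewrite -kl; case: (l) => // l'; lia.
have [c ->] : exists c : R, b = c%:A by apply: connected; rewrite -l0.
by rewrite linearZ /= f1 scaler0 scale0r; apply: degree_lt0.
Qed.

Lemma right_der_nilp (f : {linear H -> R^o}) : f 1 = 0 ->
  forall x, exists n, iter n (right_der h f) x == 0.
Proof.
move=> f1 x; have [n [g [gG xE]]] := grade_sum gr x.
have {g gG xE} : degree_lt n x by exists g.
move=> xn; exists n; elim: n x xn => [|n IHn] x.
  by case=> g [_ ->]; rewrite big_ord0.
by move=> /(right_der_degree f1)/IHn; rewrite iterSr.
Qed.

Lemma characters_separate : separating (@is_character R H).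
Proof.
have [Y YE] := grading_operator gr.
have YM := grading_operatorM gr YE.
move=> x x0; have [n [g [gG xE]]] := grade_sum gr x.
have {g gG xE} : degree_lt n x by exists g.
move=> xn; elim: n x x0 xn => [|n IHn] x x0 xn.
  by case: xn => g [_ ->]; rewrite big_ord0.
(* D_f x has lower degree, and each character χ kills it because χ ∘ exp(t D_f) kills [x] for all
   t. *)
have der0 (f : {linear H -> R^o}) : is_eps_derivation h f -> right_der h f x = 0.
  move=> fD; have f1 := eps_derivation1 fD.
  apply: IHn; last exact: right_der_degree.
  move=> chi [chi1 chiM].
  have DM := right_derM fD; have Dn := right_der_nilp f1.
  apply: (flow_char0 (D_nilp := Dn)) => t.
  by apply: x0; split; [apply: flow_char1|apply: flow_charM].
(* Contracting with [f] gives the derivation of the infinitesimal character f ∘ (a * Y) applied to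
   [x], so [der0] settles every [f]. *)
have E0 : tmap idfun (euler_map h Y) (coprod h x) = 0.
  apply: contract_right_eq0 => f.
  have fD : is_eps_derivation h (f \o euler_map h Y).
    move=> u v; rewrite -[LHS]/(f (euler_map h Y (u * v))) euler_mapM //.
    by rewrite linearD !linearZ; congr (_ + _); apply: mulrC.
  rewrite -(der0 _ fD) /right_der /=.
  elim/tensor_ind: (coprod h x) => [a b|k u v]; last by rewrite !linearP /= => -> ->.
  by rewrite tmapE !contract_rightE.
have /(grading_operator_ker gr YE)/connected[c xc] : Y x = 0.
  by rewrite -(id_conv_euler h YM) E0 linear0.
have := x0 (counit h) (conj (rmorph1 _) (rmorphM _)).
rewrite xc linearZ /= rmorph1 => /eqP; rewrite [_ *: _]mulr1 => /eqP ->.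
by rewrite scale0r.
Qed.

End CharactersSeparate.

(** * Forms on the indecomposables and the characters e^v *)

Section InfinitesimalForms.
Variables (K : fieldType) (H : algType K) (h : hopf_algebra H).

Lemma aug_proj_subproof x : x - (counit h x)%:A \in aug_pred h.
Proof. by rewrite inE linearB linearZ /= rmorph1 [_ *: _]mulr1 subrr. Qed.

(** The projection onto ker ε along the unit, used to extend forms from ker ε to H. *)
Definition aug_proj x : aug h := Aug (aug_proj_subproof x).

Lemma aug_proj_linear : linear aug_proj.
Proof.
move=> a x y; apply: val_inj; rewrite /= linearP /=.
by rewrite scalerDl -scalerA scalerBr opprD addrACA.
Qed.

HB.instance Definition _ :=
  GRing.isLinear.Build K H (aug h) *:%R aug_proj aug_proj_linear.

Lemma aug_projK (x : aug h) : aug_proj (aug_val x) = x.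
Proof.
by apply: val_inj; have := augP x; rewrite inE /= => /eqP ->; rewrite scale0r subr0.
Qed.

Lemma indec_form_infinitesimal (l : {linear indec h -> K^o}) :
  is_infinitesimal h (l \o indec_cls h \o aug_proj).
Proof.
split=> [|x xsq] /=.
  suff -> : aug_proj 1 = 0 by rewrite !linear0.
  by apply: val_inj; rewrite /= rmorph1 scale1r subrr.
have xaug : x \in aug_pred h.
  case: xsq => s sP ->; rewrite big_seq; apply: rpred_sum => p /sP[y [z ->]].
  rewrite rpredZ // inE rmorphM /=; have := augP y; rewrite inE => /eqP ->.
  by rewrite mul0r.
have -> : aug_proj x = Aug xaug by rewrite -[RHS]aug_projK.
suff -> : indec_cls h (Aug xaug) = 0 by rewrite linear0.
rewrite -(linear0 (indec_cls h)); apply/quot_clsP; rewrite subr0.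
exact/asboolP.
Qed.

Definition indec_form_infchar l : infchar h := InfChar (indec_form_infinitesimal l).

Lemma indec_form_infcharK l : infchar_indec (indec_form_infchar l) =1 l.
Proof.
move=> w; have [x ->] : exists x, w = indec_cls h x.
  by exists (repr w); rewrite /= /quot_cls reprK.
by rewrite infchar_indecE /= aug_projK.
Qed.

End InfinitesimalForms.

Section Main.
Variables (R : realType) (H : comAlgType R) (C : comb_hopf_algebra H).

(** The restriction of [l] to each component is a form on the indecomposables, that is, an
    infinitesimal character. So every character of the symmetric algebra is some e^v. *)
Lemma prim_tuple_form_surj (l : {linear indec_gens C -> R^o}) :
  exists v : prim_tuple C, prim_tuple_form v =1 l.
Proof.
have pair_lin i : linear (fun w : indec C => indec_pair w i).
  by move=> a u v; apply/ffunP => j; rewrite !ffunE; case: eqP; rewrite ?scaler0 ?addr0.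
pose pair i : {linear indec C -> indec_gens C} := HB.pack_for
  {linear indec C -> indec_gens C} (fun w => indec_pair w i)
  (GRing.isLinear.Build R (indec C) (indec_gens C) *:%R _ (pair_lin i)).
exists (fun i => indec_form_infchar (l \o pair i)) => g.
rewrite /prim_tuple_form.
have -> : g = \sum_i pair i (g i).
  apply/ffunP => j; rewrite sum_ffunE (bigD1 j) //= ffunE eqxx big1 ?addr0 // => i.
  by rewrite eq_sym ffunE => /negPf ->.
rewrite linear_sum; apply: eq_bigr => i _ /=; rewrite indec_form_infcharK /=.
congr (l (indec_pair _ i)).
rewrite sum_ffunE (bigD1 i) //= ffunE eqxx big1 ?addr0 // => j.
by rewrite eq_sym ffunE => /negPf ->.
Qed.

Lemma exp_char_separate :
  separating (fun f : {linear sym (indec_gens C) -> R^o} =>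
    exists v : prim_tuple C, f = exp_char v).
Proof.
move=> x x0; apply: separating_sym => _ [l ->].
have [v vE] := prim_tuple_form_surj l.
rewrite -(x0 (exp_char v)); last by exists v.
apply/esym/(sym_lift_unique (g := exp_char v)) => g.
by rewrite /exp_char sym_liftE; apply: vE.
Qed.

End Main.

(** * Pairings with ρ and the cointeraction *)

Lemma tform_mul (K : fieldType) (A B : algType K)
    (f : {linear A -> K^o}) (g : {linear B -> K^o}) :
  (forall x y, f (x * y) = f x * f y) -> (forall x y, g (x * y) = g x * g y) ->
  forall u v, tform f g (u * v) = tform f g u * tform f g v.
Proof.
move=> fM gM u v; elim/tensor_ind: u => [a b|k u u' uE uE']; last first.
  by rewrite mulrDl -scalerAl !linearP uE uE' mulrDl -scalerAl.
elim/tensor_ind: v => [c d|k v v' vE vE']; last first.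
  by rewrite mulrDr -scalerAr !linearP vE vE' mulrDr -scalerAr.
by rewrite tensM !tformE fM gM; apply: mulrACA.
Qed.

Lemma tform_tmap (K : fieldType) (V V' W W' : lmodType K)
    (f : {linear V' -> K^o}) (g : {linear W' -> K^o})
    (f' : {linear V -> V'}) (g' : {linear W -> W'}) x :
  tform f g (tmap f' g' x) = tform (f \o f') (g \o g') x.
Proof.
elim/tensor_ind: x => [v w|a x y]; last by rewrite !linearP /= => -> ->.
by rewrite tmapE !tformE.
Qed.

Lemma eq_tform (K : fieldType) (V W : lmodType K)
    (f f' : {linear V -> K^o}) (g g' : {linear W -> K^o}) :
  f =1 f' -> g =1 g' -> tform f g =1 tform f' g'.
Proof. by move=> ff' gg'; apply: tensor_ext => v w; rewrite !tformE ff' gg'. Qed.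

(** As [f] is multiplicative, the factor f(ac) produced by m^{1,3} splits between the two
    pairings. *)
Lemma tform_m13 (K : fieldType) (A H : algType K) (f : {linear A -> K^o})
    (chi psi : {linear H -> K^o}) :
  (forall x y, f (x * y) = f x * f y) ->
  forall u, tform f (tform chi psi) (m13 A H u) = tform (tform f chi) (tform f psi) u.
Proof.
move=> fM; elim/tensor_ind => [u v|a x y]; last by rewrite !linearP /= => -> ->.
elim/tensor_ind: u => [a b|k u u' uE uE']; last first.
  by rewrite tensDl tensZl !linearP uE uE'.
elim/tensor_ind: v => [c d|k v v' vE vE']; last first.
  by rewrite tensDr tensZr !linearP vE vE'.
by rewrite m13E !tformE fM; apply: mulrACA.
Qed.

Theorem proposition4p1 (R : realType) (H : comAlgType R)
    (C : comb_hopf_algebra H) (gamma : R)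
    (S : prim_tuple C -> {linear H -> R^o} -> {linear H -> R^o})
    (rho : {linear H -> sym (indec_gens C) ⨂ H}) :
  is_nondegenerate C -> 0 < gamma -> gamma <= 1 ->
  is_substitution gamma S -> coaction_of S rho ->
  cointeraction (sym_hopf (indec_gens C)) C rho.
Proof.
move=> _ _ _ Ssub rhoE.
have sepH : separating (@is_character R H).
  apply: (characters_separate (comb_graded C)) => x /comb_connected[a [-> _]].
  by exists a.
have sepS := @exp_char_separate R H C.
have expM (v : prim_tuple C) x y : exp_char v (x * y) = exp_char v x * exp_char v y.
  exact: rmorphM.
split=> [|x y|x|x].
- apply: (separating_eq (separating_tensor sepS sepH)).
  move=> _ [_ [chi [[v ->] chiP ->]]].
  rewrite -rhoE (subst_character Ssub v chiP).1 tformE rmorph1 chiP.1.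
  by rewrite mulr1.
- apply: (separating_eq (separating_tensor sepS sepH)).
  move=> _ [_ [chi [[v ->] chiP ->]]].
  rewrite tform_mul -?rhoE; [|exact: expM|exact: chiP.2].
  exact: (subst_character Ssub v chiP).2.
- apply: (separating_eq (separating_tensor sepS (@separating_all _ _))).
  move=> _ [_ [g [[v ->] _ ->]]].
  rewrite tform_tmap tformE rmorph1 mul1r.
  (* A form on the ground field is a scalar, which reduces the identity to S_v(ε) = ε. *)
  have gE (c : R^o) : g c = g 1 *: c.
    have {1}-> : c = c *: 1 by rewrite [RHS]mulr1.
    by rewrite linearZ; apply: mulrC.
  rewrite (eq_tform (f' := exp_char v) (g' := g 1 \*: (counit C : {linear H -> R^o}))) //.
  + rewrite [in RHS]gE -[in RHS](subst_unit Ssub v) rhoE.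
    elim/tensor_ind: (rho x) => [a b|k t u]; last first.
      by rewrite !linearP /= => -> ->.
    rewrite !tformE /=.
    exact: mulrCA.
  + by move=> z; rewrite /= gE.
- apply: (separating_eq (separating_tensor sepS
    (separating_tensor (@separating_all _ _) (@separating_all _ _)))).
  move=> _ [_ [_ [[v ->] [chi [psi [_ _ ->]]] ->]]].
  (* The left side pairs to S_v(χ * ψ), the right side to S_v(χ) * S_v(ψ). *)
  rewrite tform_tmap tform_m13 ?tform_tmap; last exact: expM.
  rewrite (eq_tform (f' := exp_char v) (g' := conv C chi psi)) //.
  rewrite -rhoE (subst_conv Ssub); apply: eq_tform => z; exact: rhoE.
Qed.
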